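(* Every subcubic planar graph with girth at least $16$ has a $(1,2^4)$-packing edge-coloring.
   Context: Graphs are finite and simple. A graph is subcubic if its maximum degree is at most $3$. The girth of a graph is the length of a shortest cycle, with the girth of a forest taken to be infinite. For distinct edges $e,f$ of $G$, the distance between $e$ and $f$ is the distance between the corresponding vertices of the line graph $L(G)$ (so edges sharing an endpoint are at distance $1$). A $(1^j,2^k)$-packing edge-coloring of $G$ is a partition of $E(G)$ into $j+k$ classes (possibly empty) such that in each of the first $j$ classes any two distinct edges are at distance at least $2$ (the class is a matching), and in each of the remaining $k$ classes any two distinct edges are at distance at least $3$ (the class is an induced matching). Thus a $(1,2^4)$-packing edge-coloring is a partition of $E(G)$ into one matching and four induced matchings. *)

(* Defs.v *)
From mathcomp Require Import all_boot all_order all_algebra.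
From mathcomp Require Import all_classical all_reals all_analysis.

Set Implicit Arguments.
Unset Strict Implicit.
Unset Printing Implicit Defensive.

Import Order.TTheory GRing.Theory Num.Theory.
Import numFieldNormedType.Exports.

Local Open Scope ring_scope.

(* A simple graph on a finite vertex type T is a symmetric and irreflexive
   relation e : rel T; its edges are the two-element sets {x, y} with e x y. *)
Definition edges (T : finType) (e : rel T) : {set {set T}} :=
  [set f : {set T} | [exists x, exists y, e x y && (f == [set x; y])]]%SET.

Definition subcubic (T : finType) (e : rel T) : Prop :=
  forall x : T, (#|[set y | e x y]%SET| <= 3)%N.

(* The bound on the size is needed because, for a symmetric e, mathcomp's
   ucycle e also holds of the sequence [:: x; y] for every edge xy, and of the
   empty sequence. *)
Definition is_graph_cycle (T : finType) (e : rel T) (c : seq T) : Prop :=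
  ucycle e c /\ (3 <= size c)%N.

(* The infimum of the empty set is +oo, so forests have infinite girth. *)
Definition girth (R : realType) (T : finType) (e : rel T) : \bar R :=
  ereal_inf [set (size c)%:R%:E | c in [set c | is_graph_cycle e c]]%classic.

(* Length of a shortest walk, +oo when there is none. *)
Definition graph_dist (R : realType) (V : finType) (adj : rel V) (x y : V) :
    \bar R :=
  ereal_inf [set (size p)%:R%:E
            | p in [set p : seq V | path adj x p /\ last x p = y]]%classic.

(* The line graph L(G); sets that are not edges of G are isolated. *)
Definition line_graph (T : finType) (e : rel T) : rel {set T} :=
  fun f g => [&& f \in edges e, g \in edges e, f != g & ~~ [disjoint f & g]].

Definition edge_dist (R : realType) (T : finType) (e : rel T)
    (f g : {set T}) : \bar R :=
  graph_dist R (line_graph e) f g.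

(* (1^j, 2^k)-packing edge-colorings: the classes C i with i < j are matchings
   and the k other ones are induced matchings. Classes may be empty. *)
Definition is_packing_edge_coloring (R : realType) (T : finType) (e : rel T)
    (j k : nat) (C : 'I_(j + k) -> {set {set T}}) : Prop :=
  [/\ (\bigcup_(i < j + k) C i)%SET = edges e,
      forall i i' : 'I_(j + k), i != i' -> [disjoint C i & C i'] &
      forall (i : 'I_(j + k)) (f g : {set T}),
        f \in C i -> g \in C i -> f != g ->
        ((if (i < j)%N then 2 else 3)%:E <= edge_dist R e f g)%E].

Definition has_packing_edge_coloring (R : realType) (T : finType) (e : rel T)
    (j k : nat) : Prop :=
  exists C : 'I_(j + k) -> {set {set T}}, is_packing_edge_coloring R e C.

Definition is_arc (R : realType) (a b : R * R) (A : set (R * R)) : Prop :=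
  exists gamma : R -> R * R,
    [/\ {within `[0, 1], continuous gamma}%classic,
        {in `[0, 1] &, injective gamma},
        gamma 0 = a, gamma 1 = b &
        A = (gamma @` `[0, 1])%classic].

(* A drawing of the graph in the real plane without crossings: the vertex x is
   the point pt x and the edge f is the arc arc f. *)
Definition is_plane_drawing (R : realType) (T : finType) (e : rel T)
    (pt : T -> R * R) (arc : {set T} -> set (R * R)) : Prop :=
  [/\ injective pt,
      forall x y : T, e x y -> is_arc (pt x) (pt y) (arc [set x; y]%SET),
      forall (f : {set T}) (x : T),
        f \in edges e -> x \notin f -> ~ arc f (pt x) &
      forall f g : {set T}, f \in edges e -> g \in edges e -> f != g ->
        (arc f `&` arc g `<=` [set pt x | x in [set` f :&: g]])%classic].

Definition planar (R : realType) (T : finType) (e : rel T) : Prop :=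
  exists (pt : T -> R * R) (arc : {set T} -> set (R * R)),
    is_plane_drawing e pt arc.

(* Main.v *)
(* The edge-colouring is extended to the cubic completion of G (add pendant edges
   until every degree is 3), where it becomes local data: each vertex x has a palette
   of three of the five colours, and the palettes of adjacent vertices share only
   colour 0 and the colour of the edge between them. In a minimal counterexample all
   degrees are 2 or 3. Call a cycle long if it has more than three times as many
   vertices as vertices of degree 3. On an induced long cycle, the cycle lemma finds a
   segment that can be removed and recoloured vertex by vertex; giving colour 0 to
   every palette on the boundary is what makes the recolouring succeed.

   A long cycle exists by an Euler-type count with girth 16 = 3 * 5 + 1: some face has
   at most five vertices of degree 3. No Jordan curve theorem is needed for this count.
   The arcs of the drawing are rounded to walks in a fine square grid, which makes G a
   minor of the grid, and the faces of a grid minor generate its cycle space, every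
   edge lying on at most two of them (MacLane). Since a graph with n3 vertices of
   degree 3 and the others of degree 2 has cycle rank at least n3/2 + 1, some generator
   meets at most five vertices of degree 3. *)

Require Import Defs.
From mathcomp Require Import all_boot all_order all_algebra.
From mathcomp Require Import all_classical all_reals all_analysis.
From mathcomp Require Import ring lra zify.

Set Implicit Arguments.
Unset Strict Implicit.
Unset Printing Implicit Defensive.

Import mathcomp.boot.fintype mathcomp.boot.fingraph mathcomp.boot.finset.

(** * MacLane bases and Euler's inequality *)

(** Rounding cannot keep two arcs apart near a common end, where their distance is zero. So each arc
    is cut at the middle of its parametrisation, and the halves leaving a vertex are collected
    around it. Halves rooted at distinct vertices have disjoint compact images, hence a positive
    distance, unless they are the two halves of one edge. A mesh finer than these finitely many
    distances leaves only that overlap to be resolved.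

    Palettes always have three colours, so deleting vertices turns edges into pendant edges of the
    completion, whose colours can be chosen anew. Compatibility ignores colour 0, so a colour of a
    palette that no coloured edge uses may be exchanged for 0. The weights 1 and -2 of the cycle
    lemma come from a finite check: two vertices of degree 2 absorb the constraint met at a
    following vertex of degree 3 whose third neighbour is already coloured. Positive total weight is
    exactly the condition that the cycle is long. When the pending colour is 0, the recolouring
    carries two alternative palettes instead of one. *)

Lemma odd_card_xor (I : finType) (A : {set I}) (P : pred I) :
  odd #|[set x in A | P x]%SET| = \big[addb/false]_(x in A) P x.
Proof.
rewrite -sum1_card (big_morph odd oddD (erefl _)).
rewrite (eq_bigl (fun x => (x \in A) && P x)) => [|x]; last by rewrite inE.
by rewrite big_mkcondr; apply: eq_bigr => x _; case: (P x).
Qed.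

Lemma xor_pred1 (I : finType) (a : I) (P : pred I) :
  \big[addb/false]_x ((x == a) && P x) = P a.
Proof.
rewrite (bigD1 a) //= eqxx /= big1 ?addbF // => x xa.
by rewrite (negPf xa).
Qed.

(* Sets of edges are sets of ordered pairs, one pair for each edge. *)
Definition inc (T : finType) (v : T) (f : T * T) : bool := (v == f.1) || (v == f.2).

Definition deg_in (T : finType) (z : {set T * T}) (v : T) : nat :=
  #|[set f in z | inc v f]%SET|.

Definition even_sub (T : finType) (A z : {set T * T}) : Prop :=
  z \subset A /\ forall v, ~~ odd (deg_in z v).

(* MacLane's criterion: the even subgraphs are generated by the family F, and
   every edge belongs to at most two of its members. *)
Definition maclane_basis (T I : finType) (A : {set T * T}) (F : I -> {set T * T}) : Prop :=
  [/\ forall i, even_sub A (F i),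
      forall f, f \in A -> #|[set i | f \in F i]%SET| <= 2 &
      forall z, even_sub A z -> exists J : {set I},
        (forall i, i \in J -> F i != set0) /\
        (forall f, f \in A -> (f \in z) = odd #|[set i in J | f \in F i]%SET|)].

(** Removing [x0] is injective on sets of even size: parity recovers whether [x0] was there. *)
Lemma card_even_sets (T : finType) (V : {set T}) (x0 : T) (E : {set {set T}}) :
  x0 \in V -> (forall U, U \in E -> (U \subset V) && ~~ odd #|U|) ->
  #|E| <= 2 ^ #|V|.-1.
Proof.
move=> x0V EP; have -> : #|V|.-1 = #|V :\ x0| by rewrite (cardsD1 x0 V) x0V.
rewrite -card_powerset -(@card_in_imset _ _ (fun U : {set T} => U :\ x0) E).
  apply/subset_leq_card/subsetP => _ /imsetP[U /EP/andP[UV _] ->].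
  by rewrite inE setSD.
move=> U1 U2 /EP/andP[_ o1] /EP/andP[_ o2] eqU.
have x0U : (x0 \in U1) = (x0 \in U2).
  move: o1 o2; rewrite (cardsD1 x0 U1) (cardsD1 x0 U2) eqU !oddD.
  by case: (x0 \in U1); case: (x0 \in U2) => //=; case: (odd _).
apply/setP => x; have [->//|xx0] := eqVneq x x0.
by have /setP/(_ x) := eqU; rewrite !inE xx0.
Qed.

Lemma odd_deg_in (T : finType) (z : {set T * T}) (v : T) :
  odd (deg_in z v) = \big[addb/false]_f ((f \in z) && inc v f).
Proof. by rewrite odd_card_xor big_mkcond; apply: eq_bigr => f _; case: (f \in z). Qed.

(** Rank-nullity over F_2, by counting. The map [par] sends the 2^#|A| subsets of [A] to even
    subsets of [V], and each nonempty fibre is a translate of the set of even subgraphs, of which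
    the generators give at most 2^N, N being the number of nonempty ones. *)
Lemma maclane_card (T I : finType) (A : {set T * T}) (F : I -> {set T * T}) (V : {set T}) (x0 : T) :
  maclane_basis A F -> x0 \in V ->
  (forall f, f \in A -> [&& f.1 != f.2, f.1 \in V & f.2 \in V]) ->
  #|A| < #|[set i | F i != set0]%SET| + #|V|.
Proof.
move=> [Fe F2 Fgen] x0V AV.
pose evenb (z : {set T * T}) := (z \subset A) && [forall v, ~~ odd (deg_in z v)].
pose Z := [set z | evenb z]%SET.
have ZP z : z \in Z -> even_sub A z by rewrite inE => /andP[zA /forallP].
have cardZ : #|Z| <= 2 ^ #|[set i | F i != set0]%SET|.
  have /fin_all_exists[J JP] (z : {set T * T}) : exists J : {set I}, z \in Z ->
      (forall i, i \in J -> F i != set0) /\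
      (forall f, f \in A -> (f \in z) = odd #|[set i in J | f \in F i]%SET|).
    have [zZ|_] := boolP (z \in Z); last by exists set0.
    by have [J JP] := Fgen _ (ZP _ zZ); exists J.
  rewrite -card_powerset -(@card_in_imset _ _ J Z).
    apply/subset_leq_card/subsetP => _ /imsetP[z zZ ->]; rewrite inE.
    by apply/subsetP => i iJ; rewrite inE; apply: (JP z zZ).1.
  move=> z1 z2 z1Z z2Z eqJ; apply/setP => f.
  have [fA|fnA] := boolP (f \in A); first by rewrite (JP _ z1Z).2 // (JP _ z2Z).2 // eqJ.
  have [s1 _] := ZP _ z1Z; have [s2 _] := ZP _ z2Z.
  have n1 : f \notin z1 by apply: contra fnA; exact: (subsetP s1).
  have n2 : f \notin z2 by apply: contra fnA; exact: (subsetP s2).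
  by rewrite (negPf n1) (negPf n2).
pose par (z : {set T * T}) := [set v | odd (deg_in z v)]%SET.
have par_even (z : {set T * T}) : z \subset A -> (par z \subset V) && ~~ odd #|par z|.
  move=> zA; apply/andP; split.
    apply/subsetP => v; rewrite inE; apply: contraLR => nv; rewrite odd_deg_in big1 // => f _.
    have [fz|//] := boolP (f \in z); have /AV/and3P[_ f1 f2] := subsetP zA _ fz.
    by apply/negbTE; rewrite negb_or; apply/andP; split; apply: contraNneq nv => ->.
  have -> : par z = [set v in setT | odd (deg_in z v)] by apply/setP => v; rewrite !inE.
  rewrite odd_card_xor (eq_bigl xpredT) => [|v]; last by rewrite inE.
  rewrite (eq_bigr (fun v => \big[addb/false]_f ((f \in z) && inc v f))); last first.
    by move=> v _; exact: odd_deg_in.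
  rewrite exchange_big /= big1 // => f _; have [fz|fz] := boolP (f \in z); last by rewrite big1.
  have /AV/and3P[f12 _ _] := subsetP zA _ fz.
  rewrite (eq_bigr (fun v => ((v == f.1) && true) (+) ((v == f.2) && true))).
    by rewrite big_split /= !(@xor_pred1 _ _ xpredT).
  move=> v _; rewrite /inc !andbT; have [->|] := eqVneq v f.1; last by [].
  by rewrite (negPf f12).
have cardP : #|par @: powerset A| <= 2 ^ #|V|.-1.
  apply: (card_even_sets x0V) => _ /imsetP[z zA ->]; apply: par_even.
  by rewrite inE in zA.
have fib U : #|[set z in powerset A | par z == U]%SET| <= #|Z|.
  have [->|[z0]] := set_0Vmem [set z in powerset A | par z == U]%SET; first by rewrite cards0.
  rewrite !inE => /andP[z0A /eqP z0U].
  (* Adding a fixed member [z0] of the fibre maps the fibre into the even subgraphs. *)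
  pose sd (z : {set T * T}) := [set f | (f \in z) (+) (f \in z0)]%SET.
  rewrite -(@card_imset _ _ sd [set z in powerset A | par z == U]); last first.
    move=> z1 z2 /setP eqz; apply/setP => f; have := eqz f; rewrite !inE.
    by case: (f \in z1); case: (f \in z2); case: (f \in z0).
  apply/subset_leq_card/subsetP => _ /imsetP[z + ->]; rewrite !inE => /andP[zA /eqP zU].
  apply/andP; split.
    apply/subsetP => f; rewrite inE.
    have [/(subsetP zA)//|_] := boolP (f \in z); exact: (subsetP z0A).
  apply/forallP => v; rewrite odd_deg_in.
  rewrite (eq_bigr (fun f => ((f \in z) && inc v f) (+) ((f \in z0) && inc v f))).
    rewrite big_split /= -!odd_deg_in.
    have : (v \in par z) = (v \in par z0) by rewrite zU z0U.
    by rewrite !inE => ->; rewrite addbb.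
  by move=> f _; rewrite inE; case: (f \in z); case: (f \in z0) => //=; case: (inc v f).
have : 2 ^ #|A| <= 2 ^ #|V|.-1 * 2 ^ #|[set i | F i != set0]%SET|.
  rewrite -card_powerset -sum1_card (partition_big_imset par) /=.
  apply: leq_trans (leq_mul cardP cardZ); rewrite -sum_nat_const.
  apply: leq_sum => U _; rewrite sum1_card; apply: leq_trans (fib U).
  by apply: subset_leq_card; apply/subsetP => z; rewrite unfold_in !inE.
rewrite -expnD leq_exp2l //; have : 0 < #|V| by apply/card_gt0P; exists x0.
lia.
Qed.

Lemma sum_mem (I : finType) (A : {set I}) : \sum_x (x \in A) = #|A|.
Proof. by rewrite -sum1_card [RHS]big_mkcond; apply: eq_bigr => x _; case: (x \in A). Qed.

Definition oedges (T : finType) (e : rel T) : {set T * T} :=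
  [set f | e f.1 f.2 && (enum_rank f.1 < enum_rank f.2)]%SET.

Definition other_end (T : finType) (v : T) (f : T * T) : T := if v == f.1 then f.2 else f.1.

Lemma oedges_neq (T : finType) (e : rel T) (f : T * T) : f \in oedges e -> f.1 != f.2.
Proof. by rewrite inE => /andP[_]; apply: contraTneq => ->; rewrite ltnn. Qed.

Lemma oedges_sym (T : finType) (e : rel T) (e_sym : symmetric e) (e_irr : irreflexive e) (u v : T) :
  e u v -> ((u, v) \in oedges e) || ((v, u) \in oedges e).
Proof.
move=> euv; rewrite !inE /= (e_sym v) euv /= -neq_ltn.
by apply: contraTneq euv => /val_inj/enum_rank_inj->; rewrite e_irr.
Qed.

Lemma other_end_inj (T : finType) (e : rel T) (v : T) :
  {in [set f in oedges e | inc v f] &, injective (other_end v)}.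
Proof.
move=> [a b] [c d]; rewrite !inE /inc /other_end /= => /andP[/andP[_ ab] i1] /andP[/andP[_ cd] i2].
move: ab cd i1 i2; have [<-|va] := eqVneq v a; have [<-|vc] := eqVneq v c => /=.
- by move=> _ _ _ _ ->.
- by move=> vb cv _ /eqP vd bc; rewrite -vd -bc in cv; have := ltn_trans vb cv; rewrite ltnn.
- by move=> av vd /eqP vb _ ad; rewrite -vb ad in av; have := ltn_trans vd av; rewrite ltnn.
- by move=> _ _ /eqP <- /eqP <- ->.
Qed.

Lemma deg_inE (T : finType) (e : rel T) (z : {set T * T}) (v : T) : z \subset oedges e ->
  deg_in z v = #|[set y | ((v, y) \in z) || ((y, v) \in z)]|.
Proof.
move=> zA; rewrite /deg_in -(card_in_imset (f := other_end v)); last first.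
  move=> f g; rewrite !inE => /andP[fz vf] /andP[gz vg].
  by apply: (@other_end_inj _ e v); rewrite inE (subsetP zA) ?vf ?vg.
congr #|pred_of_set _|; apply/setP => y; rewrite inE; apply/imsetP/idP.
  move=> [[a b]]; rewrite !inE /inc /other_end /= => /andP[ab].
  by case: eqVneq => [-> _ ->|_ /= /eqP -> ->]; rewrite ab ?orbT.
move=> /orP[vy|yv].
  by exists (v, y); rewrite ?inE ?vy /inc /other_end /= ?eqxx.
exists (y, v); rewrite ?inE ?yv /inc /other_end /= ?eqxx ?orbT //.
by case: eqVneq => // vy; have := oedges_neq (subsetP zA _ yv); rewrite /= vy eqxx.
Qed.

Lemma deg_oedges (T : finType) (e : rel T) (e_sym : symmetric e) (e_irr : irreflexive e) (v : T) :
  deg_in (oedges e) v = #|[set y | e v y]|.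
Proof.
rewrite (@deg_inE _ e) //; congr #|pred_of_set _|; apply/setP => y; rewrite [LHS]inE [RHS]inE.
apply/idP/idP; last exact: oedges_sym.
by rewrite !inE /= (e_sym y v) => /orP[/andP[]|/andP[]].
Qed.

Lemma sum_deg_in (T : finType) (e : rel T) (z : {set T * T}) : z \subset oedges e ->
  \sum_v deg_in z v = 2 * #|z|.
Proof.
move=> zA; rewrite (eq_bigr (fun v => \sum_(f in z) inc v f)) => [|v _]; last first.
  rewrite /deg_in -sum1_card (eq_bigl (fun f => (f \in z) && inc v f)) => [|f]; last by rewrite inE.
  by rewrite big_mkcondr; apply: eq_bigr => f _; case: (inc v f).
rewrite exchange_big /= mulnC -sum_nat_const; apply: eq_bigr => f fz.
have f12 := oedges_neq (subsetP zA _ fz).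
rewrite (bigD1 f.1) //= (bigD1 f.2) 1?eq_sym //= big1; first by rewrite /inc !eqxx orbT.
by move=> v /andP[v1 v2]; rewrite /inc (negPf v1) (negPf v2).
Qed.

(* By maclane_card there are more than n3/2 nonempty members of the family, if n3 is
   the number of vertices of degree 3, and each of these vertices lies on at most three
   of them. *)
Lemma maclane_light_face (T I : finType) (e : rel T) (e_sym : symmetric e)
    (e_irr : irreflexive e) (F : I -> {set T * T}) (x0 y0 : T) :
  maclane_basis (oedges e) F -> e x0 y0 ->
  (forall x y, e x y -> 2 <= #|[set z | e x z]| <= 3) ->
  exists X : {set T}, [/\ X != set0, forall x, x \in X -> 2 <= #|[set y in X | e x y]| &
    #|[set x in X | #|[set y | e x y]| == 3]| <= 5].
Proof.
move=> Fml exy deg23; have [Fe F2 _] := Fml.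
pose A := oedges e; pose d v := #|[set y | e v y]|.
pose V := [set v | 0 < d v]; pose V3 := [set v | d v == 3].
pose X i := [set v | 0 < deg_in (F i) v].
have degX i v : v \in X i -> 2 <= deg_in (F i) v.
  by rewrite inE; have [_ /(_ v)] := Fe i; case: (deg_in _ v) => [|[|]].
have XF i : F i != set0 -> X i != set0.
  move=> /set0Pn[f fF]; apply/set0Pn; exists f.1; rewrite inE.
  by apply/card_gt0P; exists f; rewrite inE fF /inc eqxx.
have XX i x : x \in X i -> 2 <= #|[set y in X i | e x y]|.
  move=> /degX; have FA := (Fe i).1; rewrite (deg_inE _ FA) => /leq_trans; apply.
  apply/subset_leq_card/subsetP => y; rewrite [_ \in _]inE => yF.
  rewrite inE; apply/andP; split.
    rewrite inE (deg_inE _ FA); apply/card_gt0P; exists x; rewrite inE orbC.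
    exact: yF.
  by case/orP: yF => /(subsetP FA); rewrite inE /= => /andP[]; rewrite // e_sym.
case: (pickP (fun i => (F i != set0) && (#|[set x in X i | x \in V3]| <= 5))) => [i /andP[Fi i5]|none].
  exists (X i); split; [exact: XF|exact: XX|].
  by apply: leq_trans i5; apply/subset_leq_card/subsetP => x; rewrite !inE.
exfalso.
(* All degrees are 0, 2 or 3. Summed over [v], this turns the handshake identity into 2 #|A| = 2
   #|V| + #|V3|. *)
have dV v : d v = 2 * (v \in V) + (v \in V3).
  rewrite !inE; have [->//|] := posnP (d v); move=> /card_gt0P[y]; rewrite inE => /deg23.
  by rewrite -/(d v); case: (d v) => [|[|[|[|]]]].
have degA v : deg_in A v = d v by exact: deg_oedges.
have cardA : 2 * #|A| = 2 * #|V| + #|V3|.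
  rewrite -(@sum_deg_in _ e) //.
  rewrite (eq_bigr (fun v => 2 * (v \in V) + (v \in V3))) => [|v _]; last by rewrite degA dV.
  by rewrite big_split /= -big_distrr /= !sum_mem.
have x0V : x0 \in V by rewrite inE; apply/card_gt0P; exists y0; rewrite inE.
have ltA := @maclane_card _ _ A F V x0 Fml x0V.
pose N := #|[set i | F i != set0]|.
have {}ltA : #|A| < N + #|V|.
  apply: ltA => f fA; rewrite (oedges_neq fA) /=; move: fA; rewrite inE => /andP[ef _].
  by rewrite !inE; apply/andP; split; apply/card_gt0P; [exists f.2|exists f.1]; rewrite inE // e_sym.
(* Each face through [v] uses at least two of its three edges, and each edge lies on at most two
   faces. *)
have le3 v : v \in V3 -> #|[set i | v \in X i]| <= 3.
  move=> v3; rewrite -(leq_pmul2l (isT : 0 < 2)).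
  apply: (@leq_trans (\sum_i deg_in (F i) v)).
    rewrite mulnC -sum_nat_const big_mkcond /=; apply: leq_sum => i _.
    by case: ifP => //; rewrite inE => /degX.
  rewrite (eq_bigr (fun i => \sum_(f in A | inc v f) (f \in F i))) => [|i _]; last first.
    rewrite /deg_in -sum1_card -big_mkcondr /=; apply: eq_bigl => f; rewrite inE.
    have [fF|] := boolP (f \in F i); last by rewrite andbF.
    by rewrite (subsetP (Fe i).1 _ fF) /= andbT.
  rewrite exchange_big /=; apply: (@leq_trans (\sum_(f in A | inc v f) 2)).
    apply: leq_sum => f /andP[fA _]; apply: leq_trans (F2 f fA).
    by rewrite -sum_mem; apply: leq_sum => i _; rewrite inE.
  rewrite sum_nat_const mulnC leq_mul2l /=; apply: leq_trans (_ : deg_in A v <= 3).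
    by apply: subset_leq_card; apply/subsetP => f fP; rewrite inE.
  by rewrite degA; move: v3; rewrite inE => /eqP->.
(* Incidences between faces and vertices of degree 3, counted twice. The result 2N <= n3 contradicts
   [ltA], which says n3 < 2N. *)
have : 6 * N <= 3 * #|V3|.
  rewrite [6 * _]mulnC -sum_nat_const.
  apply: (@leq_trans (\sum_(i in [set i | F i != set0]) #|[set x in X i | x \in V3]|)).
    apply: leq_sum => i; rewrite inE => Fi; have := none i; rewrite Fi /=.
    by rewrite leqNgt => /negbFE.
  apply: (@leq_trans (\sum_i \sum_(v in V3) (v \in X i))).
    rewrite big_mkcond /=; apply: leq_sum => i _; case: ifP => // _.
    rewrite -sum1_card -big_mkcondr /=; apply: eq_leq; apply: eq_bigl => v.
    by rewrite inE andbC.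
  rewrite exchange_big /= mulnC -sum_nat_const; apply: leq_sum => v v3.
  apply: leq_trans (le3 v v3).
  by rewrite -sum_mem; apply: leq_sum => i _; rewrite [in leqRHS]inE.
lia.
Qed.

(** * Minors of the grid *)

Definition boundary (P D : finType) (src tgt : D -> P) (z : D -> bool) (x : P) : bool :=
  \big[addb/false]_d (z d && ((src d == x) (+) (tgt d == x))).

(** Summing the boundary over [B] cancels the edges inside [B]: a cycle meets every cut evenly. *)
Lemma boundary_cut (P D : finType) (src tgt : D -> P) (z : D -> bool) (B : {set P}) :
  (forall x, boundary src tgt z x = false) ->
  \big[addb/false]_d (z d && ((src d \in B) (+) (tgt d \in B))) = false.
Proof.
move=> z0; transitivity (\big[addb/false]_(x in B) boundary src tgt z x); last by rewrite big1.
rewrite /boundary exchange_big /=; apply: eq_bigr => d _.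
rewrite big_mkcond /=.
rewrite (eq_bigr (fun x => ((x == src d) && (z d && (x \in B))) (+) ((x == tgt d) && (z d && (x \in B))))).
  by rewrite big_split /= !(xor_pred1 _ (fun x => z d && (x \in B))); case: (z d).
move=> x _; rewrite !(eq_sym x); case: (x \in B); case: (z d); rewrite ?andbF ?andbT //=.
Qed.

Lemma boundary_xor (P D I : finType) (src tgt : D -> P) (z : {set I}) (g : I -> D -> bool) (x : P) :
  boundary src tgt (fun d => \big[addb/false]_(f in z) g f d) x =
  \big[addb/false]_(f in z) boundary src tgt (g f) x.
Proof.
rewrite /boundary exchange_big /=; apply: eq_bigr => d _; case: (_ (+) _).
  by rewrite andbT; apply: eq_bigr => f _; rewrite andbT.
by rewrite andbF big1 // => f _; rewrite andbF.
Qed.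

(* The graph e is a minor of the 1-skeleton (P, D) of a planar cell complex with set of
   cells Q, the branch set of v being B v. The members of the MacLane basis are
   the boundaries of the faces of the minor. *)
Lemma maclane_of_cells (P D Q : finType) (src tgt : D -> P) (lf rt : D -> Q) (ok : pred D)
    (T : finType) (e : rel T) (B : T -> {set P}) (org : T -> P) :
  (forall (S : Q -> bool) x, boundary src tgt (fun d => S (lf d) (+) S (rt d)) x = false) ->
  (forall z : D -> bool, (forall d, z d -> ok d) -> (forall x, boundary src tgt z x = false) ->
     exists S : Q -> bool, forall d, z d = S (lf d) (+) S (rt d)) ->
  (forall v w p, p \in B v -> p \in B w -> v = w) ->
  (forall f, f \in oedges e -> exists ep : D, exists g : D -> bool,
     [/\ (src ep \in B f.1) && (tgt ep \in B f.2) || (src ep \in B f.2) && (tgt ep \in B f.1),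
         forall x, boundary src tgt g x = (x == org f.1) (+) (x == org f.2),
         g ep &
         forall d, g d -> ok d /\ (d = ep \/ exists w, (src d \in B w) && (tgt d \in B w))]) ->
  exists F : Q -> {set T * T}, maclane_basis (oedges e) F.
Proof.
move=> dd0 exact Bdis lift; pose A := oedges e.
(* The edge [d0] is only the default value of the choice function below; if there is none, [A] is
   empty. *)
have [D0|[d0 _]] := set_0Vmem [set: D].
  exists (fun=> set0); have A0 f : f \in A -> False.
    by move=> /lift[ep _]; have := in_setT ep; rewrite D0 inE.
  split=> [i|f /A0 //|z _].
    by split=> [|v]; [exact: sub0set|rewrite odd_deg_in big1 // => f _; rewrite inE].
  by exists set0; split=> [i|f /A0 //]; rewrite inE.
have /fin_all_exists[eg egP] f : exists eg : D * (D -> bool), f \in A ->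
     [/\ (src eg.1 \in B f.1) && (tgt eg.1 \in B f.2) || (src eg.1 \in B f.2) && (tgt eg.1 \in B f.1),
         forall x, boundary src tgt eg.2 x = (x == org f.1) (+) (x == org f.2),
         eg.2 eg.1 &
         forall d, eg.2 d -> ok d /\ (d = eg.1 \/ exists w, (src d \in B w) && (tgt d \in B w))].
  have [fA|] := boolP (f \in A); last by exists (d0, fun=> false).
  by have [ep [g]] := lift f fA; exists (ep, g).
pose eps f := (eg f).1; pose g f := (eg f).2.
have inB v w p : p \in B v -> (p \in B w) = (v == w).
  by move=> pv; apply/idP/eqP => [/(Bdis _ _ _ pv)//|<-].
have eps_ends f v : f \in A -> (src (eps f) \in B v) (+) (tgt (eps f) \in B v) = inc v f.
  move=> fA; have f12 := oedges_neq fA; have [+ _ _ _] := egP f fA; rewrite /inc -/(eps f) !(eq_sym v).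
  case/orP => /andP[s1 t1]; rewrite (inB _ _ _ s1) (inB _ _ _ t1).
    by have [<-|] := eqVneq f.1 v; rewrite // eq_sym (negPf f12).
  by rewrite addbC; have [<-|] := eqVneq f.1 v; rewrite // eq_sym (negPf f12).
have eps_inj : {in A &, injective eps}.
  move=> f h fA hA eq_eps.
  have eqi v : inc v f = inc v h by rewrite -!eps_ends // eq_eps.
  move: fA hA eqi {eq_eps}; case: f h => [a b] [c d]; rewrite !inE /inc /= => /andP[_ ab] /andP[_ cd] eqi.
  have := eqi a; have := eqi b; rewrite !eqxx orbT /= => /esym bcd /esym acd.
  have nab : a != b by apply: contraTneq ab => ->; rewrite ltnn.
  case/orP: acd => /eqP ea; case/orP: bcd => /eqP eb; rewrite ea eb // in ab nab *.
  - by rewrite eqxx in nab.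
  - by have := ltn_trans ab cd; rewrite ltnn.
  - by rewrite eqxx in nab.
pose inner d := [exists w, (src d \in B w) && (tgt d \in B w)].
have eps_outer f : f \in A -> ~~ inner (eps f).
  move=> fA; apply/negP => /existsP[w /andP[sw tw]].
  have := eps_ends f w fA; rewrite sw tw /= => /esym/negbT; rewrite negb_or => /andP[w1 w2].
  have := eps_ends f f.1 fA; rewrite (inB _ _ _ sw) (inB _ _ _ tw) addbb.
  by rewrite /inc eqxx.
(* [H] is the subgraph carrying the minor. Its faces are the classes of cells joined across edges
   outside [H], and [root adj] names them. *)
pose H d := inner d || (d \in eps @: A).
pose adj (a b : Q) := [exists d, ~~ H d && ((lf d == a) && (rt d == b) || (lf d == b) && (rt d == a))].
have adj_sym : symmetric adj.
  by move=> a b; apply: eq_existsb => d; rewrite orbC.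
have /rootP rootE : connect_sym adj := sym_connect_sym adj_sym.
have nH_root d : ~~ H d -> root adj (lf d) = root adj (rt d).
  by move=> nHd; apply/rootE/connect1/existsP; exists d; rewrite nHd !eqxx.
pose F i := [set f in A | (root adj (lf (eps f)) == i) (+) (root adj (rt (eps f)) == i)].
have FE f i : f \in A -> (f \in F i) = (root adj (lf (eps f)) == i) (+) (root adj (rt (eps f)) == i).
  by move=> fA; rewrite inE fA.
exists F; split.
- move=> i; split=> [|v]; first by apply/subsetP => f; rewrite inE => /andP[].
  (* The boundary of face [i] meets the cut of [B v] evenly. Inner edges do not cross this cut and
     edges outside [H] have the same face on both sides, so only edges [eps f] with [f] at [v] are
     counted. *)
  pose z d := (root adj (lf d) == i) (+) (root adj (rt d) == i).
  have := @boundary_cut _ _ src tgt z (B v) (dd0 (fun q => root adj q == i)).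
  rewrite (bigID (mem (eps @: A))) /= [X in _ (+) X]big1 ?addbF => [|d dA]; last first.
    have [|nHd] := boolP (H d); last by rewrite /z nH_root // addbb.
    rewrite /H (negPf dA) orbF => /existsP[w /andP[sw tw]].
    by rewrite (inB _ _ _ sw) (inB _ _ _ tw) addbb andbF.
  rewrite big_imset //= odd_deg_in => zv; apply/negbT; rewrite -[RHS]zv [RHS]big_mkcond /=.
  apply: eq_bigr => f _; rewrite [f \in F i]inE; case: ifP => //= fA.
  by rewrite eps_ends.
- move=> f fA; apply: leq_trans (_ : #|[set root adj (lf (eps f)); root adj (rt (eps f))]| <= _).
    apply/subset_leq_card/subsetP => i; rewrite inE FE // !inE !(eq_sym i).
    by case: (_ == i).
  by rewrite cards2; case: (_ != _).
(* [zt] lifts [z] to the complex. At each [org v] the boundary is the parity of the degree of [v] in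
   [z], so [zt] is a cycle and bounds a set [S] of cells. *)
- move=> z [zA zev]; pose zt d := \big[addb/false]_(f in z) g f d.
  have gok f d : f \in A -> g f d -> ok d /\ (d = eps f \/ inner d).
    move=> fA /[dup] gfd; have [_ _ _ /(_ d gfd)[okd h]] := egP f fA; split=> //.
    by case: h => [->|h]; [left|right; apply/existsP].
  have zt_ok d : zt d -> exists2 f, f \in z & g f d.
    move=> ztd; have [/existsP[f /andP[fz gfd]]|/existsPn none] := boolP [exists f, (f \in z) && g f d].
      by exists f.
    move: ztd; rewrite /zt big1 // => f fz; have := none f.
    by rewrite fz /= => /negbTE.
  have [||S SP] := exact zt.
  + by move=> d /zt_ok[f /(subsetP zA) fA /(gok _ _ fA)[]].
  + move=> x; rewrite boundary_xor.
    rewrite (eq_bigr (fun f => \big[addb/false]_v ((v == f.1) && (x == org v)) (+)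
        \big[addb/false]_v ((v == f.2) && (x == org v)))); last first.
      by move=> f /(subsetP zA)/egP[_ -> _ _]; rewrite !(xor_pred1 _ (fun v => x == org v)).
    rewrite (eq_bigr (fun f => \big[addb/false]_v (inc v f && (x == org v)))); last first.
      move=> f /(subsetP zA)/oedges_neq f12; rewrite -big_split; apply: eq_bigr => v _ /=.
      rewrite /inc; have [->|] := eqVneq v f.1; rewrite ?addFb //.
      by rewrite (negPf f12) /= addbF.
    rewrite exchange_big /= big1 // => v _; have [xv|xv] := eqVneq x (org v); last first.
      by rewrite big1 // => f _; rewrite andbF.
    under eq_bigr do rewrite andbT.
    have /negbTE zv := zev v; rewrite big_mkcond -[RHS]zv odd_deg_in.
    by apply: eq_bigr => f _; case: (f \in z).
  have zt_eps f : f \in A -> zt (eps f) = (f \in z).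
    move=> fA; have g_eps h : h \in A -> g h (eps f) = (h == f).
      move=> hA; apply/idP/eqP => [/(gok _ _ hA)[_ []]|->].
      - by move=> /eps_inj -> .
      - by rewrite (negPf (eps_outer f fA)).
      - by have [] := egP f fA.
    have [fz|fz] := boolP (f \in z).
      rewrite /zt (bigD1 f) //= g_eps // eqxx big1 // => h /andP[/(subsetP zA) hA hf].
      by rewrite g_eps // (negPf hf).
    rewrite /zt big1 // => h hz; rewrite g_eps ?(subsetP zA) //.
    by apply: contraNF fz => /eqP <-.
  (* Since [zt] vanishes outside [H], [S] is constant on each face, hence a union of faces. *)
  have S_root q : S q = S (root adj q).
    have /connectP[p pp ->] := connect_root adj q.
    elim: p q pp => //= a p IHp q /andP[/existsP[d /andP[nHd dqa]] /IHp <-].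
    have : zt d = false.
      apply: contraNF nHd => /zt_ok[f fz gfd]; have [_ [->|id]] := gok _ _ (subsetP zA _ fz) gfd.
        by rewrite /H imset_f ?orbT // (subsetP zA).
      by rewrite /H id.
    by rewrite SP; case/orP: dqa => /andP[/eqP-> /eqP->]; case: (S q); case: (S a).
  exists [set i | S i && (F i != set0)]; split=> [i|f fA]; first by rewrite inE => /andP[].
  rewrite -zt_eps // SP (S_root (lf _)) (S_root (rt _)).
  set a := root adj _; set b := root adj _.
  have [ab|ab] := eqVneq a b.
    rewrite ab addbb; symmetry; apply/negbTE; rewrite (_ : [set i in _ | _] = set0) ?cards0 //.
    by apply/setP => i; rewrite in_set FE // -/a -/b ab addbb andbF in_set0.
  have fF i : (f \in F i) = (i == a) (+) (i == b) by rewrite FE // -/a -/b !(eq_sym i).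
  have Fa : F a != set0 by apply/set0Pn; exists f; rewrite fF eqxx (negPf ab).
  have Fb : F b != set0 by apply/set0Pn; exists f; rewrite fF eqxx eq_sym (negPf ab).
  rewrite odd_card_xor (eq_bigl (fun i => S i && (F i != set0))) => [|i]; last by rewrite inE.
  rewrite big_mkcond (eq_bigr (fun i => ((i == a) && S i) (+) ((i == b) && S i))).
    by rewrite big_split /= !xor_pred1.
  move=> i _; rewrite fF; have [->|ia] := eqVneq i a; first by rewrite Fa (negPf ab) andbT /= addbF; case: (S a).
  have [->|ib] := eqVneq i b; first by rewrite Fb andbT /=; case: (S b).
  by case: ifP.
Qed.

Lemma boundary_addb (P D : finType) (src tgt : D -> P) (g h : D -> bool) (x : P) :
  boundary src tgt (fun d => g d (+) h d) x = boundary src tgt g x (+) boundary src tgt h x.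
Proof.
by rewrite /boundary -big_split; apply: eq_bigr => d _ /=; rewrite andb_addl.
Qed.

Lemma boundary_pred1 (P D : finType) (src tgt : D -> P) (d : D) (x : P) :
  boundary src tgt (pred1 d) x = (src d == x) (+) (tgt d == x).
Proof. exact: (xor_pred1 d (fun d => (src d == x) (+) (tgt d == x))). Qed.

(* The square grid on the torus: a vertex p is the source of the horizontal
   edge (p, true) and of the vertical edge (p, false), and the lower left corner
   of the cell p. *)
Definition torus_tgt (m : nat) (d : ('I_m * 'I_m) * bool) : 'I_m * 'I_m :=
  if d.2 then (ordS d.1.1, d.1.2) else (d.1.1, ordS d.1.2).

(** The cell across the edge [d] from the cell [d.1]: below a horizontal edge, to the left of a
    vertical one. Wrapping around makes it total. *)
Definition torus_rt (m : nat) (d : ('I_m * 'I_m) * bool) : 'I_m * 'I_m :=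
  if d.2 then (d.1.1, ord_pred d.1.2) else (ord_pred d.1.1, d.1.2).

(* The edges that do not wrap around. *)
Definition torus_ok (n : nat) (d : ('I_n.+1 * 'I_n.+1) * bool) : bool :=
  if d.2 then d.1.1 < n else d.1.2 < n.

Lemma torus_boundaryE (m : nat) (z : ('I_m * 'I_m) * bool -> bool) (x : 'I_m * 'I_m) :
  boundary (fun d => d.1) (@torus_tgt m) z x =
  (z (x, true) (+) z ((ord_pred x.1, x.2), true)) (+)
  (z (x, false) (+) z ((x.1, ord_pred x.2), false)).
Proof.
rewrite /boundary.
rewrite (eq_bigr (fun d => z (d.1, d.2) && ((d.1 == x) (+) (torus_tgt (d.1, d.2) == x)))) => [|[] //].
rewrite -(pair_bigA _ (fun p b => z (p, b) && ((p == x) (+) (torus_tgt (p, b) == x)))) /=.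
rewrite (eq_bigr (fun p =>
  (((p == x) && z (p, true)) (+) ((p == (ord_pred x.1, x.2)) && z (p, true))) (+)
  (((p == x) && z (p, false)) (+) ((p == (x.1, ord_pred x.2)) && z (p, false))))).
  by rewrite !big_split /= !(xor_pred1 _ (fun p => z (p, true))) !(xor_pred1 _ (fun p => z (p, false))).
move=> p _; rewrite big_bool; case: x p => [x1 x2] [p1 p2]; rewrite /torus_tgt /= !xpair_eqE.
have e1 (a b : 'I_m) : (ordS a == b) = (a == ord_pred b).
  by apply/eqP/eqP => [<-|->]; rewrite ?ordSK ?ord_predK.
rewrite !e1; case: (z _); case: (z _); rewrite ?andbT ?andbF ?addbF //=.
Qed.

Lemma torus_dd0 (m : nat) (S : 'I_m * 'I_m -> bool) (x : 'I_m * 'I_m) :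
  boundary (fun d => d.1) (@torus_tgt m) (fun d => S d.1 (+) S (torus_rt d)) x = false.
Proof.
rewrite torus_boundaryE /torus_rt /=; case: x => [i j] /=.
by case: (S _); case: (S _); case: (S _); case: (S _).
Qed.

(** Ray parity: [S i k] counts modulo 2 the horizontal edges of [z] met when going down from the
    cell (i, k). The vanishing boundary, applied row by row, gives the vertical edges. *)
Lemma torus_exact (n : nat) (z : ('I_n.+1 * 'I_n.+1) * bool -> bool) :
  (forall d, z d -> torus_ok d) ->
  (forall x, boundary (fun d => d.1) (@torus_tgt n.+1) z x = false) ->
  exists S : 'I_n.+1 * 'I_n.+1 -> bool, forall d, z d = S d.1 (+) S (torus_rt d).
Proof.
move=> z_ok dz.
pose zh i k := z ((i, inord k), true); pose zv i k := z ((i, inord k), false).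
pose S i k := \big[addb/false]_(l < k.+1) zh i l.
have pred0 : ord_pred (ord0 : 'I_n.+1) = inord n.
  by apply: val_inj; rewrite /= inordK // modn_small.
have predS k : k < n -> ord_pred (inord k.+1 : 'I_n.+1) = inord k.
  move=> kn; apply: val_inj; rewrite /= !inordK ?ltnS ?(ltnW kn) //=.
  by rewrite modnDr modn_small // ltnS ltnW.
have ord_inord (i : 'I_n.+1) : inord i = i by exact: inord_val.
have zvn i : zv i n = false.
  by apply: contraTF isT => /z_ok; rewrite /torus_ok /= inordK // ltnn.
have zhn k : zh (inord n) k = false.
  by apply: contraTF isT => /z_ok; rewrite /torus_ok /= inordK // ltnn.
have xor_step a b c d x y : a (+) b = x -> (c (+) d) (+) (y (+) x) = false ->
    (a (+) c) (+) (b (+) d) = y by case: a b c d x y => [] [] [] [] [] [].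
have xor_last a b : b = (a (+) b) (+) a by case: a b => [] [].
have Sv i k : k <= n -> S i k (+) S (ord_pred i) k = zv i k.
  elim: k => [_|k IHk kn].
    have := dz (i, inord 0); rewrite torus_boundaryE /= -!/(zh _ _) -!/(zv _ _).
    have -> : ord_pred (inord 0 : 'I_n.+1) = inord n by rewrite (ord_inord ord0).
    rewrite -/(zv _ _) zvn addbF /S !big_ord1.
    by case: (zh _ _); case: (zh _ _); case: (zv _ _).
  have := dz (i, inord k.+1); rewrite torus_boundaryE /= predS // -!/(zh _ _) -!/(zv _ _).
  have := IHk (ltnW kn); rewrite /S !(big_ord_recr k.+1) /=; exact: xor_step.
(* The top row of cells is adjacent to row 0 on the torus, so its parity must be 0. This propagates
   from column 0, whose left neighbour is the column [n] free of horizontal edges. *)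
have Sn i : i <= n -> S (inord i) n = false.
  elim: i => [_|i IHi lin].
    have := Sv (inord 0) n (leqnn n); rewrite zvn.
    have -> : ord_pred (inord 0 : 'I_n.+1) = inord n by rewrite (ord_inord ord0).
    by rewrite {2}/S big1 ?addbF.
  by have := Sv (inord i.+1) n (leqnn n); rewrite zvn predS // IHi 1?ltnW // addbF.
exists (fun q : 'I_n.+1 * 'I_n.+1 => S q.1 q.2) => -[[i j] [|]]; rewrite /torus_rt /=; last first.
  by rewrite Sv; [rewrite /zv ord_inord|rewrite -ltnS].
have in_ : i <= n by rewrite -ltnS.
have eqz : z (i, j, true) = zh i j by rewrite /zh ord_inord.
rewrite eqz; case: j {eqz} => [[|k] kn] /=.
  by rewrite modn_small // -{3}(ord_inord i) Sn // addbF /S big_ord1.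
rewrite modnDr modn_small ?(ltnW kn) // /S (big_ord_recr k.+1) /=.
exact: xor_last.
Qed.

Definition natgrid_adj (p q : nat * nat) : bool :=
  (p.1 == q.1) && ((q.2 == p.2.+1) || (p.2 == q.2.+1)) ||
  (p.2 == q.2) && ((q.1 == p.1.+1) || (p.1 == q.1.+1)).

(* The edge uv is drawn as the walks root u :: W u v and root v :: W v u, which
   end at the same point. *)
Definition is_grid_drawing (T : finType) (e : rel T) (n : nat)
    (root : T -> nat * nat) (W : T -> T -> seq (nat * nat)) : Prop :=
  [/\ forall u v, e u v -> path natgrid_adj (root u) (W u v),
      forall u v, e u v -> last (root u) (W u v) = last (root v) (W v u),
      forall u v p, e u v -> p \in root u :: W u v -> (p.1 < n)%N && (p.2 < n)%N,
      forall u v u' v' p, e u v -> e u' v' -> u != u' ->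
        p \in root u :: W u v -> p \in root u' :: W u' v' -> u' = v /\ v' = u &
      forall u v w, e v w -> u != v -> root u \notin root v :: W v w].

(** Coordinates below [n] are put in ['I_n.+1], so that a step to the next one never wraps. *)
Definition torus_pt (n : nat) (p : nat * nat) : 'I_n.+1 * 'I_n.+1 := (inord p.1, inord p.2).

Lemma torus_edge (n : nat) (p q : nat * nat) :
  (p.1 < n) && (p.2 < n) -> (q.1 < n) && (q.2 < n) -> natgrid_adj p q ->
  exists2 d, torus_ok d &
    (d.1 == torus_pt n p) && (torus_tgt d == torus_pt n q) ||
    (d.1 == torus_pt n q) && (torus_tgt d == torus_pt n p).
Proof.
case: p q => [p1 p2] [q1 q2] /= /andP[p1n p2n] /andP[q1n q2n].
have ordS_inord k : k < n -> ordS (inord k : 'I_n.+1) = inord k.+1.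
  by move=> kn; apply: val_inj; rewrite /= !inordK ?ltnS // ?(ltnW kn) // modn_small.
rewrite /natgrid_adj /= => /orP[] /andP[/eqP <- /orP[]/eqP eq_k].
- exists (torus_pt n (p1, p2), false); first by rewrite /torus_ok /= inordK // ltnW.
  by rewrite /torus_tgt /torus_pt /= ordS_inord // eq_k !eqxx.
- exists (torus_pt n (p1, q2), false); first by rewrite /torus_ok /= inordK // ltnW.
  by rewrite /torus_tgt /torus_pt /= ordS_inord // eq_k !eqxx orbT.
- exists (torus_pt n (p1, p2), true); first by rewrite /torus_ok /= inordK // ltnW.
  by rewrite /torus_tgt /torus_pt /= ordS_inord // eq_k !eqxx.
- exists (torus_pt n (q1, p2), true); first by rewrite /torus_ok /= inordK // ltnW.
  by rewrite /torus_tgt /torus_pt /= ordS_inord // eq_k !eqxx orbT.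
Qed.

(** The chain is the sum modulo 2 of the steps; a walk may repeat edges, but cancellation does not
    affect the boundary. *)
Lemma walk_chain (n : nat) (B : {set 'I_n.+1 * 'I_n.+1}) (p : nat * nat) (s : seq (nat * nat)) :
  path natgrid_adj p s -> {in p :: s, forall q, (q.1 < n) && (q.2 < n)} ->
  {in p :: s, forall q, torus_pt n q \in B} ->
  exists g : ('I_n.+1 * 'I_n.+1) * bool -> bool,
    (forall x, boundary (fun d => d.1) (@torus_tgt n.+1) g x =
       (x == torus_pt n p) (+) (x == torus_pt n (last p s))) /\
    (forall d, g d -> [&& torus_ok d, d.1 \in B & torus_tgt d \in B]).
Proof.
elim: s p => [|q s IHs] p /=.
  by move=> _ _ _; exists (fun=> false); split=> // x; rewrite addbb /boundary big1.
move=> /andP[pq qs] lt_n inB.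
have [g [bg gB]] : _ := IHs q qs (fun r rs => lt_n r (mem_behead (s := p :: _) rs))
  (fun r rs => inB r (mem_behead (s := p :: _) rs)).
have p0 : p \in [:: p, q & s] by exact: mem_head.
have q0 : q \in [:: p, q & s] by rewrite inE mem_head orbT.
have [d okd ends] := torus_edge (lt_n _ p0) (lt_n _ q0) pq.
exists (fun d' => pred1 d d' (+) g d'); split.
  move=> x; rewrite boundary_addb boundary_pred1 bg !(eq_sym x).
  by case/orP: ends => /andP[/eqP-> /eqP->]; do 3!case: (_ == x).
move=> d' /=; have [-> _|_ /= /gB //] := eqVneq d' d; rewrite okd /=.
by case/orP: ends => /andP[/eqP-> /eqP->]; rewrite !inB.
Qed.

Lemma first_exit (U : eqType) (P : pred U) (a : U) (s : seq U) :
  P a -> ~~ P (last a s) ->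
  exists s1 q s2, [/\ s = s1 ++ q :: s2, all P (a :: s1) & ~~ P q].
Proof.
elim: s a => [|b s IHs] a /= Pa; first by rewrite Pa.
have [Pb /(IHs b Pb)[s1 [q [s2 [-> P1 nq]]]]|nb _] := boolP (P b).
  by exists (b :: s1), q, s2; rewrite /= Pa.
by exists [::], b, s; rewrite /= Pa.
Qed.

(* Where the walks of two adjacent branch sets meet, the vertex of larger rank
   wins; the edge of the minor is then the first exit from the losing set. *)
Lemma grid_drawing_maclane (T : finType) (e : rel T) (e_sym : symmetric e) (e_irr : irreflexive e)
    (n : nat) (root : T -> nat * nat) (W : T -> T -> seq (nat * nat)) :
  is_grid_drawing e n root W ->
  exists (Q : finType) (F : Q -> {set T * T}), maclane_basis (oedges e) F.
Proof.
move=> [Wpath Wlast Wlt Wdis rootW].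
(* [cl v p]: some walk from [v] passes through [p]. [lab] awards [p] to the claimant of largest
   rank, which makes the branch sets disjoint. *)
pose cl v p := [exists w, e v w && (p \in root v :: W v w)].
pose lab v p := cl v p && [forall w, cl w p ==> (enum_rank w <= enum_rank v)].
pose B v := [set x : 'I_n.+1 * 'I_n.+1 | lab v (val x.1, val x.2)].
have lab_uniq v w p : lab v p -> lab w p -> v = w.
  move=> /andP[cv /forallP mv] /andP[cw /forallP mw].
  apply/enum_rank_inj/val_inj/anti_leq.
  by rewrite (implyP (mv w) cw) (implyP (mw v) cv).
have ptB v p : (p.1 < n) && (p.2 < n) -> (torus_pt n p \in B v) = lab v p.
  by case: p => [p1 p2] /= /andP[l1 l2]; rewrite inE /= !inordK ?ltnS // ltnW.
exists ('I_n.+1 * 'I_n.+1)%type.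
apply: (@maclane_of_cells _ _ _ (fun d => d.1) (@torus_tgt n.+1) (fun d => d.1) (@torus_rt n.+1)
  (@torus_ok n) T e B (fun v => torus_pt n (root v))).
- exact: torus_dd0.
- exact: torus_exact.
- by move=> v w p; rewrite !inE; exact: lab_uniq.
move=> [u v] /[dup] fA; rewrite inE /= => /andP[euv ruv].
have evu : e v u by rewrite e_sym.
have uv : u != v by exact: (oedges_neq fA).
have clu p : p \in root u :: W u v -> cl u p by move=> pW; apply/existsP; exists v; rewrite euv.
have clv p : p \in root v :: W v u -> cl v p by move=> pW; apply/existsP; exists u; rewrite evu.
(* On the walk from [v] towards [u] the only possible rival is [u], of smaller rank; so this walk
   lies entirely in [B v]. *)
have lab_v p : p \in root v :: W v u -> lab v p.
  move=> pW; rewrite /lab clv //=; apply/forallP => w; apply/implyP => /existsP[x /andP[ewx pW']].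
  have [->//|wv] := eqVneq v w.
  by have [-> _] := Wdis _ _ _ _ _ evu ewx wv pW pW'; exact: ltnW.
have lab_uv p : p \in root u :: W u v -> ~~ lab u p -> p \in root v :: W v u /\ lab v p.
  move=> pW nlab; suff pW' : p \in root v :: W v u by split=> //; exact: lab_v.
  move: nlab; rewrite /lab clu //= negb_forall => /existsP[w]; rewrite negb_imply -ltnNge.
  move=> /andP[/existsP[x /andP[ewx pW']] uw].
  have nuw : u != w by apply: contraTneq uw => ->; rewrite ltnn.
  by have [wv xu] := Wdis _ _ _ _ _ euv ewx nuw pW pW'; rewrite wv xu in pW'.
have lab_root : lab u (root u).
  apply: contraT => /(lab_uv _ (mem_head _ _))[].
  by rewrite (negPf (rootW _ _ _ evu uv)).
have last_v : ~~ lab u (last (root u) (W u v)).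
  rewrite Wlast //; apply/negP => lu; have := lab_uniq _ _ _ lu (lab_v _ (mem_last _ _)).
  by move=> eq_uv; rewrite eq_uv eqxx in uv.
have [s1 [q [s2 [eqW /allP lab1 nq]]]] := first_exit lab_root last_v.
have qW : q \in root u :: W u v by rewrite eqW inE mem_cat mem_head !orbT.
have [qW' labq] := lab_uv _ qW nq.
have := Wpath _ _ euv; rewrite eqW cat_path /= => /and3P[path1 adj_q _].
have sub1 : {subset root u :: s1 <= root u :: W u v}.
  by move=> x; rewrite eqW !inE mem_cat => /orP[->//|->]; rewrite orbT.
have [|x xs|g1 [bg1 g1B]] := @walk_chain n (B u) _ _ path1.
- by move=> x /sub1; exact: Wlt.
- by rewrite ptB ?lab1 //; apply: Wlt (sub1 _ xs).
have [r [path2 sub2 last2]] : exists r, [/\ path natgrid_adj (root v) r,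
    {subset root v :: r <= root v :: W v u} & last (root v) r = q].
  move: qW'; rewrite inE => /predU1P[->|qin]; first by exists [::]; split=> // x; rewrite !inE => ->.
  move: (Wpath _ _ evu); move: (W v u) qin => w /splitPr[r1 r2].
  rewrite -cat_rcons cat_path => /andP[pr _]; exists (rcons r1 q); split=> //; last by rewrite last_rcons.
  by move=> x; rewrite !inE mem_cat => /orP[->//|->]; rewrite orbT.
have [|x xs|g2 [bg2 g2B]] := @walk_chain n (B v) _ _ path2.
- by move=> x /sub2; exact: Wlt.
- by rewrite ptB ?lab_v //; [exact: sub2|apply: Wlt (sub2 _ xs)].
have pW : last (root u) s1 \in root u :: W u v by apply: sub1; exact: mem_last.
have [d okd ends] := torus_edge (Wlt _ _ _ euv pW) (Wlt _ _ _ euv qW) adj_q.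
have pB : torus_pt n (last (root u) s1) \in B u by rewrite ptB ?lab1 ?mem_last //; exact: Wlt euv pW.
have qB : torus_pt n q \in B v by rewrite ptB //; exact: Wlt euv qW.
have disB x : x \in B u -> x \in B v -> false.
  by rewrite !inE => /lab_uniq h /h eq_uv; rewrite eq_uv eqxx in uv.
exists d, (fun d' => g1 d' (+) (pred1 d d' (+) g2 d')); split=> /=.
- by case/orP: ends => /andP[/eqP-> /eqP->]; rewrite pB qB ?orbT.
- move=> x; rewrite !boundary_addb boundary_pred1 bg1 bg2 last2 !(eq_sym x).
  by case/orP: ends => /andP[/eqP-> /eqP->]; do 4!case: (_ == x).
(* The crossing edge [d] must survive in the sum: it joins [B u] to [B v], whereas each of the two
   chains stays in one branch set. *)
- have -> : g1 d = false.
    apply/negbTE/negP => /g1B/and3P[_ d1 d2]; case/orP: ends => /andP[/eqP s /eqP t].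
      by rewrite t in d2; have := disB _ d2 qB.
    by rewrite s in d1; have := disB _ d1 qB.
  have -> : g2 d = false; last by rewrite eqxx.
  apply/negbTE/negP => /g2B/and3P[_ d1 d2]; case/orP: ends => /andP[/eqP s /eqP t].
    by rewrite s in d1; have := disB _ pB d1.
  by rewrite t in d2; have := disB _ pB d2.
move=> d'; have [->|nd] := eqVneq d' d; first by split=> //; left.
rewrite addFb; have [/g1B/and3P[okd' b1 b2] _|_ /= /g2B/and3P[okd' b1 b2]] := boolP (g1 d').
  by split=> //; right; exists u; rewrite b1.
by split=> //; right; exists v; rewrite b1.
Qed.

(** * Palettes *)

(* The palette of a vertex x in a (1,2^4)-packing edge-colouring of the cubic
   completion of the graph: the list of the three colours around x. Colour 0 is
   the matching, 1, ..., 4 are the induced matchings. *)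
Definition palettes : seq (seq nat) :=
  [seq s <- [seq a :: s | a <- iota 0 5, s <- [seq [:: b; c] | b <- iota 0 5, c <- iota 0 5]]
   | uniq s].

Lemma palettesP (s : seq nat) : (s \in palettes) = [&& size s == 3, uniq s & all (fun k => k < 5) s].
Proof.
apply/idP/idP => [|/and3P[]].
  by move: s; apply/allP; vm_compute.
case: s => [|a [|b [|c [|]]]] //= _ us /and4P[].
by move: a b c us; do 3!case=> [|[|[|[|[|?]]]]] //.
Qed.

(* On the palettes of the ends of an edge of colour k: another common colour, if it is
   not 0, would be that of two edges at distance 2. *)
Definition compat (s t : seq nat) (k : nat) : bool :=
  [&& k \in s, k \in t & all (fun j => (j \in t) ==> (j == 0) || (j == k)) s].

(* A state [:: k; a; b] is the palette of a vertex that has a pending edge of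
   colour k. *)
Definition zstates : seq (seq nat) := [seq s <- palettes | 0 \in s].

(* The states [:: k'; k; l] of a vertex joined to a vertex of state s along its pending
   edge, of colour k; the colour l is that of a third edge, real or pendant. *)
Definition exts (s : seq nat) : seq (seq nat) :=
  [seq t <- [seq t <- palettes | nth 0 t 1 == head 0 s] | compat s t (head 0 s)].

(** The third edge now leads to an already coloured vertex of state [x], along the pending edge of
    that vertex. *)
Definition joins (s x : seq nat) : seq (seq nat) :=
  [seq t <- exts s | (nth 0 t 2 == head 0 x) && compat x t (head 0 x)].

(** The outcome of one block: two vertices of degree 2, then one of degree 3 with outer neighbour of
    state [x]. *)
Definition joins3 (s x : seq nat) : seq (seq nat) :=
  flatten [seq joins u x | u <- flatten [seq exts v | v <- exts s]].

(* The invariant of the recolouring of a path: every state of one of these families can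
   be given to the last vertex coloured. *)
Definition families : seq (seq (seq nat)) :=
  [seq [:: s] | s <- zstates & head 0 s != 0] ++
  [seq F <- [seq [:: s; [:: 0; c; nth 0 s 2]] | s <- zstates, c <- iota 0 5] |
     (head 0 (head [::] F) == 0) && (nth 0 (last [::] F) 1 \notin head [::] F)].

(** The first recoloured vertex can be given a palette containing 0 and a nonzero pending colour, so
    that its state alone is a family. *)
Lemma color_start : all (fun s => has (fun t => (0 \in t) && (head 0 t != 0)) (exts s)) zstates.
Proof. by vm_compute. Qed.

(** Exhaustive check that a block preserves the invariant. A family is one state with a nonzero
    pending colour, or two states of pending colour 0 with palettes {0, a, b} and {0, c, b}. *)
Lemma color_step : all (fun F => all (fun x =>
  let O := flatten [seq joins3 s x | s <- F] in
  has (fun F' => all (mem O) F') families) zstates) families.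
Proof. by vm_compute. Qed.

(** The closing block of three vertices of degree 2; the last one, [t], also meets the coloured
    vertex of state [x] at the far end. The state [s] taken from the family may depend on [x]. *)
Lemma color_end : all (fun F => all (fun x =>
  has (fun s => has (fun u => has (fun v => has (fun t =>
    (head 0 t == head 0 x) && compat x t (head 0 x)) (exts v)) (exts u)) (exts s)) F)
  zstates) families.
Proof. by vm_compute. Qed.

Lemma compat_sym (s t : seq nat) (k : nat) : compat s t k = compat t s k.
Proof.
rewrite /compat andbCA; congr [&& _, _ & _].
by apply/allP/allP => h j js; apply/implyP => jt; apply: (implyP (h j jt) js).
Qed.

Lemma eq_compat (s s' t t' : seq nat) (k : nat) : s =i s' -> t =i t' -> compat s t k = compat s' t' k.
Proof.
move=> es et; rewrite /compat es et (eq_all_r es); congr [&& _, _ & _].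
by apply: eq_all => j; rewrite et.
Qed.

Lemma extsP (s t : seq nat) : t \in exts s ->
  [/\ t \in palettes, nth 0 t 1 = head 0 s & compat s t (head 0 s)].
Proof. by rewrite !mem_filter => /and3P[? /eqP ? ?]. Qed.

Lemma joinsP (s x t : seq nat) : t \in joins s x ->
  [/\ t \in exts s, nth 0 t 2 = head 0 x & compat x t (head 0 x)].
Proof. by rewrite mem_filter => /andP[/andP[/eqP ? ?] ?]. Qed.

Lemma palette3 (t : seq nat) : t \in palettes ->
  exists a b c, [/\ t = [:: a; b; c], a != b, a != c & b != c].
Proof.
rewrite palettesP => /and3P[]; case: t => [|a [|b [|c [|]]]] //= _.
rewrite !inE negb_or => /and3P[/andP[ab ac] bc _] _; by exists a, b, c.
Qed.

Lemma palette_head (s : seq nat) (k : nat) : s \in palettes -> 0 \in s -> k \in s ->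
  exists2 s', s' \in zstates & head 0 s' = k /\ s =i s'.
Proof.
move=> sP s0 ks; have ps := perm_to_rem ks.
exists (k :: rem k s); last by split=> //; exact: perm_mem.
rewrite mem_filter -(perm_mem ps) s0; move: sP; rewrite !palettesP => /and3P[s3 us s5].
by rewrite -(perm_size ps) s3 -(perm_uniq ps) us -(perm_all _ ps).
Qed.

(* Vertices outside W are not coloured; the colours of the edges of G[V] from W
   to V \ W are reserved by c. *)
Definition partial_coloring (T : finType) (e : rel T) (V W : {set T})
    (S : T -> seq nat) (c : T -> T -> nat) : Prop :=
  [/\ forall x, x \in W -> S x \in palettes,
      forall x y, x \in W -> y \in V -> e x y -> c x y \in S x,
      forall x y z, x \in W -> y \in V -> z \in V -> e x y -> e x z -> c x y = c x z -> y = z &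
      forall x y, x \in W -> y \in W -> e x y -> c x y = c y x /\ compat (S x) (S y) (c x y)].

Definition colorable (T : finType) (e : rel T) (V : {set T}) : Prop :=
  exists S c, partial_coloring e V V S c.

Definition upd (T : eqType) (U : Type) (f : T -> U) (u : T) (a : U) : T -> U :=
  fun x => if x == u then a else f x.

Lemma color_vertex (T : finType) (e : rel T) (e_sym : symmetric e) (e_irr : irreflexive e)
    (V W : {set T}) (S : T -> seq nat) (c : T -> T -> nat) (u : T) (t : seq nat) (cu : T -> nat) :
  partial_coloring e V W S c -> u \notin W -> t \in palettes ->
  (forall y, y \in V -> e u y -> cu y \in t) ->
  (forall y z, y \in V -> z \in V -> e u y -> e u z -> cu y = cu z -> y = z) ->
  (forall y, y \in W -> e u y -> cu y = c y u /\ compat (S y) t (cu y)) ->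
  partial_coloring e V (u |: W) (upd S u t) (upd c u cu).
Proof.
move=> [SP cS cinj cE] uW tP cut cuinj cuE; rewrite /upd.
have neu x : x \in W -> (x == u) = false by move=> xW; apply: contraNF uW => /eqP <-.
split.
- by move=> x; rewrite in_setU1; have [->|_ /SP] := eqVneq x u.
- by move=> x y; rewrite in_setU1; have [->|_] := eqVneq x u; [move=> _; exact: cut|exact: cS].
- by move=> x y z; rewrite in_setU1; have [->|_] := eqVneq x u; [move=> _; exact: cuinj|exact: cinj].
- move=> x y; rewrite !in_setU1; have [->|xu] := eqVneq x u => /=; have [->|yu] := eqVneq y u => //=.
  + by rewrite e_irr.
  + move=> _ yW uy; have [-> co] := cuE y yW uy; split=> //.
    by rewrite compat_sym; move: co; have [->] := cuE y yW uy.
  + by move=> xW _; rewrite e_sym => ux; have [eqc co] := cuE x xW ux; rewrite -eqc.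
  + exact: cE.
Qed.

Lemma color_path_vertex (T : finType) (e : rel T) (e_sym : symmetric e) (e_irr : irreflexive e)
    (V W : {set T}) (S : T -> seq nat) (c : T -> T -> nat) (p v q : T) (s t : seq nat) :
  partial_coloring e V W S c -> W \subset V -> v \notin W -> p \in W -> q \notin W ->
  (forall y, y \in V -> e v y -> y = p \/ y = q) ->
  S p =i s -> c p v = head 0 s -> t \in exts s ->
  exists S' c', [/\ partial_coloring e V (v |: W) S' c',
    forall x, x \in W -> S' x = S x /\ c' x = c x, S' v = t & c' v q = head 0 t].
Proof.
move=> cW WV vW pW qW nb eqS eqc /extsP[tP t1 co].
have [a [b [d [et ab ad bd]]]] := palette3 tP; have {}t1 : b = head 0 s by rewrite -t1 et.
have qp : (q == p) = false by apply: contraNF qW => /eqP ->.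
(* The palette is [[:: a; b; d]]: [b] goes back to [p], [a] is reserved for [q], and [d] is left to
   the pendant edge. *)
exists (upd S v t), (upd c v (fun y => if y == p then b else a)); split.
- apply: color_vertex => //.
  + by move=> y _ _; rewrite et !inE; case: ifP => _; rewrite eqxx ?orbT.
  + move=> y z yV zV /(nb _ yV)[->|->] /(nb _ zV)[->|->] //; rewrite ?eqxx ?qp => eab.
      by rewrite eab eqxx in ab.
    by rewrite eab eqxx in ab.
  + move=> y yW /(nb _ (subsetP WV _ yW))[->|eyq]; last by rewrite -eyq yW in qW.
    by rewrite eqxx t1 eqc; split=> //; rewrite (eq_compat _ eqS (fun=> erefl)).
- by move=> x xW; rewrite /upd; case: eqVneq xW vW => // -> ->.
- by rewrite /upd eqxx.
- by rewrite /upd eqxx qp et.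
Qed.

Lemma color_branch_vertex (T : finType) (e : rel T) (e_sym : symmetric e) (e_irr : irreflexive e)
    (V W : {set T}) (S : T -> seq nat) (c : T -> T -> nat) (p x v q : T) (s s' t : seq nat) :
  partial_coloring e V W S c -> W \subset V -> v \notin W -> p \in W -> x \in W -> x != p -> q \notin W ->
  (forall y, y \in V -> e v y -> [\/ y = p, y = q | y = x]) ->
  S p =i s -> c p v = head 0 s -> S x =i s' -> c x v = head 0 s' -> t \in joins s s' ->
  exists S' c', [/\ partial_coloring e V (v |: W) S' c',
    forall x, x \in W -> S' x = S x /\ c' x = c x, S' v = t & c' v q = head 0 t].
Proof.
move=> cW WV vW pW xW xp qW nb eqS eqc eqS' eqc' /joinsP[/extsP[tP t1 co] t2 co'].
have [a [b [d [et ab ad bd]]]] := palette3 tP; have {}t1 : b = head 0 s by rewrite -t1 et.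
have {}t2 : d = head 0 s' by rewrite -t2 et.
have qp : (q == p) = false by apply: contraNF qW => /eqP ->.
have qx : (q == x) = false by apply: contraNF qW => /eqP ->.
exists (upd S v t), (upd c v (fun y => if y == p then b else if y == x then d else a)); split.
- apply: color_vertex => //.
  + by move=> y _ _; rewrite et !inE; do 2?case: ifP => _; rewrite eqxx ?orbT.
  + move=> y z yV zV /(nb _ yV)[->|->|->] /(nb _ zV)[->|->|->] //; rewrite ?eqxx ?qp ?qx ?(negPf xp);
      by move=> eab; move: ab ad bd; rewrite eab eqxx.
  + move=> y yW /(nb _ (subsetP WV _ yW))[->|eyq|->].
    * by rewrite eqxx t1 eqc; split=> //; rewrite (eq_compat _ eqS (fun=> erefl)).
    * by rewrite -eyq yW in qW.
    * by rewrite eqxx (negPf xp) t2 eqc'; split=> //; rewrite (eq_compat _ eqS' (fun=> erefl)).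
- by move=> y yW; rewrite /upd; case: eqVneq yW vW => // -> ->.
- by rewrite /upd eqxx.
- by rewrite /upd eqxx qp qx et.
Qed.

Lemma color_last_vertex (T : finType) (e : rel T) (e_sym : symmetric e) (e_irr : irreflexive e)
    (V W : {set T}) (S : T -> seq nat) (c : T -> T -> nat) (p v q : T) (s s' t : seq nat) :
  partial_coloring e V W S c -> W \subset V -> v \notin W -> p \in W -> q \in W -> q != p ->
  (forall y, y \in V -> e v y -> y = p \/ y = q) ->
  S p =i s -> c p v = head 0 s -> S q =i s' -> c q v = head 0 s' ->
  t \in exts s -> head 0 t = head 0 s' -> compat s' t (head 0 s') ->
  exists S' c', partial_coloring e V (v |: W) S' c'.
Proof.
move=> cW WV vW pW qW /negPf qp nb eqS eqc eqS' eqc' /extsP[tP t1 co] t2 co'.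
have [a [b [d [et ab ad bd]]]] := palette3 tP; have {}t1 : b = head 0 s by rewrite -t1 et.
have {}t2 : a = head 0 s' by rewrite -t2 et.
exists (upd S v t), (upd c v (fun y => if y == p then b else a)).
apply: color_vertex => //.
- by move=> y _ _; rewrite et !inE; case: ifP => _; rewrite eqxx ?orbT.
- move=> y z yV zV /(nb _ yV)[->|->] /(nb _ zV)[->|->] //; rewrite ?eqxx ?qp => eab.
    by rewrite eab eqxx in ab.
  by rewrite eab eqxx in ab.
- move=> y yW /(nb _ (subsetP WV _ yW))[->|->].
    by rewrite eqxx t1 eqc; split=> //; rewrite (eq_compat _ eqS (fun=> erefl)).
  by rewrite qp t2 eqc'; split=> //; rewrite (eq_compat _ eqS' (fun=> erefl)).
Qed.

(* A vertex with a pending edge can always have 0 in its palette: this only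
   allows more common colours. *)
Lemma reserve_colors (T : finType) (e : rel T) (e_sym : symmetric e) (V W : {set T}) (S : T -> seq nat) (c : T -> T -> nat) :
  partial_coloring e W W S c -> W \subset V -> (forall x, x \in W -> #|[set y in V | e x y]| <= 3) ->
  exists S' c', partial_coloring e V W S' c' /\
    forall x y, x \in W -> y \in V -> y \notin W -> e x y -> 0 \in S' x.
Proof.
move=> [SP cS cinj cE] WV deg3.
have /fin_all_exists[sc scP] x : exists sc : seq nat * (T -> nat), x \in W ->
  [/\ sc.1 \in palettes, forall y, y \in W -> sc.2 y = c x y,
      forall y, y \in V -> e x y -> sc.2 y \in sc.1,
      forall y z, y \in V -> z \in V -> e x y -> e x z -> sc.2 y = sc.2 z -> y = z &
      (forall k, k \in sc.1 -> k != 0 -> k \in S x) /\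
      forall y, y \in V -> y \notin W -> e x y -> 0 \in sc.1].
  have [xW|] := boolP (x \in W); last by exists ([::], c x).
  have [/subsetP NW|] := boolP ([set y in V | e x y] \subset W).
    have inW y : y \in V -> e x y -> y \in W by move=> yV xy; apply: NW; rewrite inE yV.
    exists (S x, c x) => _ /=; split=> //.
    - exact: SP.
    - by move=> y yV xy; apply: cS => //; exact: inW.
    - by move=> y z yV zV xy xz; apply: cinj => //; exact: inW.
    - by split=> // y yV yW xy; rewrite inW in yW.
  case/subsetPn=> y0; rewrite inE => /andP[y0V xy0] y0W.
  pose N := [set y in V | e x y]; pose U := [seq c x y | y in [set y in W | e x y]].
  have UE y : y \in W -> e x y -> c x y \in U by move=> yW xy; apply: image_f; rewrite inE yW.
  have sN : #|[set y in W | e x y]| + #|N :\: W| <= 3.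
    rewrite (_ : [set y in W | e x y] = N :&: W); first by rewrite cardsID deg3.
    apply/setP => y; rewrite !inE; have [/(subsetP WV) ->|] := boolP (y \in W); first by rewrite andbT.
    by rewrite andbF.
  have N0 : 0 < #|N :\: W| by apply/card_gt0P; exists y0; rewrite !inE y0W y0V.
  have sU : size U = #|[set y in W | e x y]| by rewrite size_image.
  have := SP x xW; rewrite palettesP => /and3P[/eqP S3 Su S5].
  (* Because of [y0], at most two edges at [x] stay inside [W], so some colour [f] of the palette is
     on none of them; it can be traded for 0. *)
  have [f fS fU] : exists2 f, f \in S x & f \notin U.
    have [/hasP[f fS fU]|/hasPn h] := boolP (has (fun f => f \notin U) (S x)); first by exists f.
    have : size (S x) <= size U by apply: uniq_leq_size => // f /h; rewrite negbK.
    by rewrite S3 sU; move: sN N0; lia.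
  pose s := if 0 \in S x then S x else 0 :: rem f (S x).
  have sP : s \in palettes.
    rewrite /s; case: ifP => n0; first exact: SP.
    rewrite palettesP /= size_rem // S3 rem_uniq // andbT /=.
    rewrite (contraFN (@mem_rem _ f (S x) 0)) //=.
    by apply/allP => k /mem_rem /(allP S5).
  have sk k : k \in s -> k != 0 -> k \in S x.
    by rewrite /s; case: ifP => // _; rewrite inE => /predU1P[->//|/mem_rem].
  have s0 : 0 \in s by rewrite /s; case: ifP => // _; rewrite mem_head.
  have sUsub k : k \in S x -> k \in U -> k \in s.
    rewrite /s; case: ifP => // _ kS kU; rewrite inE mem_rem_uniq // inE kS andbT.
    by apply/orP; right; apply: contraNneq fU => <-.
  have := sP; rewrite palettesP => /and3P[/eqP s3 su s5].
  pose free := [seq k <- s | k \notin U].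
  have sfree : #|N :\: W| <= size free.
    have : size [seq k <- s | k \in U] <= size U.
      by apply: uniq_leq_size; [rewrite filter_uniq|move=> k; rewrite mem_filter => /andP[]].
    have cnt : size [seq k <- s | k \in U] + size free = 3.
      by rewrite !size_filter -s3 (count_predC (fun k => k \in U)).
    move=> hU; move: cnt sN; rewrite -sU => cnt sN; move: hU.
    by rewrite -(leq_add2r (size free)) cnt => /(leq_trans sN); rewrite leq_add2l.
  (* The neighbours outside [W] receive the free colours in the order of their enumeration, hence
     distinct ones. *)
  pose ix y := index y (enum (N :\: W)).
  have ixP y : y \in V -> y \notin W -> e x y -> ix y < size free.
    move=> yV yW xy; apply: leq_trans sfree; rewrite cardE index_mem mem_enum.
    by rewrite !inE yW yV.
  have free_in y : y \in V -> y \notin W -> e x y -> nth 0 free (ix y) \in free.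
    by move=> yV yW xy; apply: mem_nth; exact: ixP.
  exists (s, fun y => if y \in W then c x y else nth 0 free (ix y)) => _ /=; split=> //.
  - by move=> y ->.
  - move=> y yV xy; case: ifP => [yW|/negbT yW]; first by apply: sUsub; [exact: cS|exact: UE].
    by have := free_in y yV yW xy; rewrite mem_filter => /andP[].
  - move=> y z yV zV xy xz; case: ifP => [yW|/negbT yW]; case: ifP => [zW|/negbT zW].
    + exact: cinj.
    + move=> eq_c; have := free_in z zV zW xz; rewrite -eq_c mem_filter => /andP[].
      by rewrite UE.
    + move=> eq_c; have := free_in y yV yW xy; rewrite eq_c mem_filter => /andP[].
      by rewrite UE.
    + move=> /eqP; rewrite nth_uniq ?ixP ?filter_uniq // => /eqP eq_ix.
      have yN : y \in enum (N :\: W) by rewrite mem_enum !inE yW yV.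
      have zN : z \in enum (N :\: W) by rewrite mem_enum !inE zW zV.
      by rewrite -(nth_index y yN) -/(ix y) eq_ix nth_index.
exists (fun x => (sc x).1), (fun x => (sc x).2); split; last first.
  by move=> x y xW yV yW xy; have [_ _ _ _ [_ h]] := scP x xW; exact: h yV yW xy.
split.
- by move=> x /scP[].
- by move=> x y /scP[_ _ h _ _]; exact: h.
- by move=> x y z /scP[_ _ _ h _]; exact: h.
- move=> x y xW yW xy; have [_ cx cxs _ [kx _]] := scP x xW; have [_ cy cys _ [ky _]] := scP y yW.
  have [eqc /and3P[k1 k2 /allP ka]] := cE x y xW yW xy.
  rewrite cx // cy //; split=> //; apply/and3P; split.
  + by rewrite -(cx y yW); apply: cxs => //; exact: (subsetP WV).
  + by rewrite eqc -(cy x xW); apply: cys; [exact: (subsetP WV)|rewrite e_sym].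
  + apply/allP => j jx; apply/implyP => jy; have [//|j0] := eqVneq j 0.
    by have := ka j (kx j jx j0); rewrite (ky j jy j0) (negPf j0).
Qed.

(** * Recolouring a cycle *)

(* Paths that can be coloured starting from one end, true standing for a vertex of
   degree 2 and false for a vertex of degree 3. *)
Fixpoint fillable (w : seq bool) : bool :=
  match w with
  | [:: true; true; true] => true
  | true :: true :: false :: w' => fillable w'
  | _ => false
  end.

Definition ballot (w : seq bool) : Prop :=
  forall k, k <= size w -> 2 * count negb (take k w) <= count id (take k w).

Lemma fillable_cat3 (w : seq bool) : fillable w -> exists w', w = w' ++ nseq 3 true.
Proof.
move: {2}(size w).+1 (ltnSn (size w)) => n; elim: n w => // n IHn.
case=> [|[] [|[] [|[] w]]] //=; last first.
  move=> sw /IHn[|w' ->]; last by exists [:: true, true, false & w'].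
  by move: sw; lia.
by case: w => // _ _; exists [::].
Qed.

Lemma fillable_rep (k : nat) : fillable (flatten (nseq k [:: true; true; false]) ++ nseq 3 true).
Proof. by elim: k. Qed.

Lemma ballot_behead (a : seq bool) (w : seq bool) :
  ballot (a ++ w) -> count id a = 2 * count negb a -> ballot w.
Proof.
move=> lw ca k kw; have := lw (size a + k); rewrite size_cat leq_add2l => /(_ kw).
by rewrite take_cat ltnNge leq_addr addKn /= !count_cat; lia.
Qed.

(** A ballot word starts with two [true]. A third one completes a fillable prefix; a [false] brings
    the weight back to 0, and what follows is again a ballot word. *)
Lemma ballot_parse (w : seq bool) : ballot w ->
  (exists w1 r, w = w1 ++ r /\ fillable w1) \/
  exists k r, w = flatten (nseq k [:: true; true; false]) ++ r /\
    [\/ r = [::], r = [:: true] | r = [:: true; true]].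
Proof.
move: {2}(size w).+1 (ltnSn (size w)) => n; elim: n w => // n IHn w.
case: w => [_ _|x1 w]; first by right; exists 0, [::]; split=> //; exact: Or31.
case: w => [|x2 w].
  move=> _ /(_ 1 isT) /=; case: x1 => // _.
  by right; exists 0, [:: true]; split=> //; exact: Or32.
case: w => [|x3 w].
  move=> _ /[dup] /(_ 1 isT) /= + /(_ 2 isT) /=; case: x1 => //; case: x2 => // _ _.
  by right; exists 0, [:: true; true]; split=> //; exact: Or33.
move=> sw lw; have := lw 1 isT; have := lw 2 isT; rewrite /= ?take0 /=.
case: x1 x2 sw lw => [] [] // sw lw _ _; case: x3 sw lw => sw lw.
  by left; exists [:: true; true; true], w.
have lw' : ballot w by apply: (@ballot_behead [:: true; true; false]).
have sw' : size w < n by move: sw => /=; lia.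
have [[w1 [r [-> f1]]]|[k [r [-> hr]]]] := IHn w sw' lw'.
  by left; exists [:: true, true, false & w1], r.
by right; exists k.+1, r.
Qed.

(* The cycle lemma, with weight 1 for true and -2 for false. *)
Lemma cycle_lemma (w : seq bool) : 2 * count negb w < count id w ->
  exists i, forall k, 0 < k <= size w ->
    2 * count negb (take k (rot i w)) < count id (take k (rot i w)).
Proof.
move=> hw; have sw : 0 < size w by case: w hw.
(* The weight of the prefix of length [i], shifted by 2 * [size w] so that the subtraction in [nat]
   is exact. *)
pose h i := count id (take i w) + 2 * (size w - count negb (take i w)).
have cn i : count negb (take i w) <= size w.
  by apply: leq_trans (count_size _ _) _; rewrite size_take; case: ltnP => // /ltnW.
have hn : h 0 < h (size w) by rewrite /h take0 take_size /=; have := cn (size w); rewrite take_size; lia.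
(* A lexicographic minimum in one number: the least [h i], and among those the last [i]. Being last
   makes the later prefixes strictly heavier. *)
case: (arg_minnP (fun i : 'I_(size w) => (h i) * (size w).+1 + (size w - i)) (isT : xpredT (Ordinal sw))).
move=> i _ imin; have hi j : j < size w -> h i * (size w).+1 + (size w - i) <= h j * (size w).+1 + (size w - j).
  by move=> js; exact: (imin (Ordinal js)).
have hle j : j <= size w -> h i <= h j.
  rewrite leq_eqVlt => /predU1P[->|/hi hj]; first by have := hi 0 sw; have := ltn_ord i; nia.
  by rewrite leqNgt; apply/negP => lt; have := ltn_ord i; nia.
have hlt j : i < j <= size w -> h i < h j.
  case/andP=> ij; rewrite leq_eqVlt => /predU1P[->|js].
    by apply: leq_ltn_trans hn; apply: hle.
  by have := hi j js; have := hle j (ltnW js); have := ltn_ord i; nia.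
exists i => k /andP[k0 ks]; rewrite /rot take_cat size_drop.
have takeD j : i <= j -> take j w = take i w ++ take (j - i) (drop i w).
  by move=> ij; rewrite -{1}(cat_take_drop i w) take_cat size_take ltn_ord ltnNge ij.
have iS := ltn_ord i.
have [kd|dk] := ltnP k (size w - i).
  have ik : i < i + k <= size w by lia.
  have := hlt (i + k) ik; rewrite /h (takeD (i + k)) ?leq_addr // addKn !count_cat.
  have := cn (i + k); rewrite (takeD (i + k)) ?leq_addr // addKn count_cat.
  lia.
have ki : k - (size w - i) <= size w by lia.
have := hle _ ki.
have eqw : count id w = count id (take i w) + count id (drop i w) by rewrite -count_cat cat_take_drop.
have eqw' : count negb w = count negb (take i w) + count negb (drop i w) by rewrite -count_cat cat_take_drop.
rewrite take_takel; last lia.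
rewrite /h !count_cat; have := cn (k - (size w - i)); have := cn i.
lia.
Qed.

(** The word is read cyclically, [Q] being stable under rotation. In the first outcome [t] stays
    coloured and the extra [true] is the starting vertex; in the second a single vertex, of degree
    3, is both ends of the segment. *)
Lemma cyclic_word (Q : seq bool -> Prop) (w : seq bool) :
  (forall w i, Q w -> Q (rot i w)) -> Q w -> 4 < size w -> 2 * count negb w < count id w ->
  exists w1, fillable w1 /\
    ((exists t r, Q [:: t, true & w1 ++ r]) \/ Q (false :: w1)).
Proof.
move=> Qrot Qw sw /cycle_lemma[i]; rewrite -(size_rot i w).
have {Qw} : Q (rot i w) by exact: Qrot.
rewrite -(size_rot i) in sw.
move: (rot i w) sw => {i}w sw Qw lw.
have Qcat x y : Q (x ++ y) -> Q (y ++ x) by move=> /Qrot; move/(_ (size x)); rewrite rot_size_cat.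
have done w1 r : fillable w1 -> r != [::] -> Q (true :: w1 ++ r) -> exists w1, fillable w1 /\
    ((exists t r, Q [:: t, true & w1 ++ r]) \/ Q (false :: w1)).
  case/lastP: r => // r t f1 _ Q1; exists w1; split=> //; left; exists t, r.
  by have := Qcat (true :: w1 ++ r) [:: t]; rewrite /= -catA cats1; apply.
case: w sw Qw lw => // x w sw Qw lw.
have := lw 1; rewrite /= take0 => /(_ isT); case: x sw Qw lw => //= sw Qw lw _.
have /ballot_parse : ballot w.
  by move=> k kw; have := lw k.+1; rewrite /= => /(_ kw); lia.
case=> [[w1 [r [eqw f1]]]|[k [r [eqw hr]]]].
  have [r0|r0] := eqVneq r [::]; last by apply: (done w1 r) => //; rewrite -eqw.
  move: sw Qw; rewrite eqw r0 cats0.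
  (* The segment fills the cycle and leaves no room for [t]. The size bound excludes four [true], so
     the last three can be rotated to the front to give a shorter segment. *)
  case: w1 f1 {eqw} => [|[] [|[] [|[] w1]]] //=; first by case: w1.
  move=> f1 _ Qw; have [w' eqw'] := fillable_cat3 f1.
  apply: (done [:: true; true; true] [:: true, true, false & w']) => //.
  by have := Qcat ([:: true; true; true; false] ++ w') (nseq 3 true); rewrite -catA -eqw'; apply.
case: k eqw => [|k] eqw; first by move: sw; rewrite eqw; case: hr => ->.
pose u := flatten (nseq k [:: true; true; false]).
have eqwu : w = [:: true; true; false] ++ u ++ r by rewrite eqw /= /u.
have uE : [:: true; true; false] ++ u = u ++ [:: true; true; false].
  by rewrite /u; elim: (k) => //= n IHn; rewrite IHn.
move: Qw; rewrite eqwu; case: hr => -> Qw.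
(* Up to rotation, this word of total weight 1 is the only source of the second outcome. *)
- exists (u ++ nseq 3 true); split; first exact: fillable_rep; right.
  have := Qcat [:: true; true; true] (false :: u); rewrite /= cats0 in Qw *; exact.
- apply: (done [:: true; true; true] (false :: u)) => //.
  by have := Qcat ([:: true, true, true, false & u]) [:: true]; apply.
- apply: (done [:: true; true; true] [:: true, false & u]) => //.
  by have := Qcat ([:: true, true, true, false & u]) [:: true; true]; apply.
Qed.

(** Induction on the blocks of the fillable word; [t] is the last coloured vertex and [s] the
    coloured vertex behind the path. Every state of [F] must be realisable, because the outer state
    met by the next block decides which one is used. Nothing changes on [W0], so the colours
    reserved there, including those at [s], remain valid even if [s] is the starting vertex. *)
Lemma fill_path (T : finType) (e : rel T) (e_sym : symmetric e) (e_irr : irreflexive e)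
    (V W0 C : {set T}) (S0 : T -> seq nat) (c0 : T -> T -> nat) (nx : T -> T) (Z : pred T) :
  partial_coloring e V W0 S0 c0 ->
  (forall x y, x \in W0 -> y \in V -> y \notin W0 -> e x y -> 0 \in S0 x) ->
  (forall p, p \in C -> nx p \in C /\ e p (nx p)) ->
  (forall p y, p \in C -> Z (nx p) -> y \in V -> e (nx p) y -> y = p \/ y = nx (nx p)) ->
  (forall p, p \in C -> ~~ Z (nx p) -> exists x, [/\ x \in V, x \notin C, e (nx p) x &
     forall y, y \in V -> e (nx p) y -> [\/ y = p, y = nx (nx p) | y = x]]) ->
  (forall x, x \in V -> x \notin C -> x \in W0) ->
  forall (l : seq T) (t s : T) (W : {set T}) (F : seq (seq nat)),
  fillable (map Z l) -> path (frel nx) t (rcons l s) -> t \in C -> t \in W ->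
  W0 \subset W -> W \subset V -> uniq l -> (forall x, x \in V -> (x \in W) = (x \notin l)) ->
  {subset l <= V} -> s \in W0 -> F \in families ->
  (forall o, o \in F -> exists S c, [/\ partial_coloring e V W S c,
     forall x, x \in W0 -> S x = S0 x /\ c x = c0 x, S t =i o & c t (nx t) = head 0 o]) ->
  colorable e V.
Proof.
move=> col0 norm0 nxC hZ hB outC l.
have [S0P c0S _ _] := col0.
have pending x y : x \in W0 -> y \in V -> y \notin W0 -> e x y ->
    exists2 s', s' \in zstates & head 0 s' = c0 x y /\ S0 x =i s'.
  by move=> xW yV yW xy; apply: palette_head; [exact: S0P|exact: norm0 xy|exact: c0S].
move: {2}(size l).+1 (ltnSn (size l)) => n; elim: n l => // n IHn l.
case: l => [|v1 [|v2 [|v3 l]]] //; try by move=> ? ? ? ? ? /=; case: (Z v1); try case: (Z v2).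
move=> sl t s W F fl pl tC tW W0W WV ul Wl lV sW0 FF real.
have W0V := subset_trans W0W WV.
have [Z1 Z2] : Z v1 /\ Z v2 by move: fl => /=; case: (Z v1); case: (Z v2).
move: pl => /= /and4P[/eqP e1 /eqP e2 /eqP e3 pl].
have [C1 t1] := nxC t tC; rewrite e1 in C1 t1.
have [C2 t2] := nxC v1 C1; rewrite e2 in C2 t2.
have [C3 t3] := nxC v2 C2; rewrite e3 in C3 t3.
have [v1V v2V v3V] : [/\ v1 \in V, v2 \in V & v3 \in V].
  by split; apply: lV; rewrite !inE eqxx ?orbT.
have n1W : v1 \notin W by rewrite Wl // !inE eqxx.
have n2W : v2 \notin W by rewrite Wl // !inE eqxx ?orbT.
have n3W : v3 \notin W by rewrite Wl // !inE eqxx ?orbT.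
move: (ul) => /= /and4P[]; rewrite !inE !negb_or => /and3P[v12 v13 v1l] /andP[v23 v2l] v3l ul'.
have nb1 y : y \in V -> e v1 y -> y = t \/ y = v2.
  by have := hZ t y tC; rewrite e1 e2; exact.
have nb2 y : y \in V -> e v2 y -> y = v1 \/ y = v3.
  by have := hZ v1 y C1; rewrite e2 e3; exact.
have add12 o u1 u2 : o \in F -> u1 \in exts o -> u2 \in exts u1 ->
    exists S c, [/\ partial_coloring e V (v2 |: (v1 |: W)) S c,
      forall x, x \in W0 -> S x = S0 x /\ c x = c0 x, S v2 = u2 & c v2 v3 = head 0 u2].
  move=> oF u1P u2P; have [S [c [cW agr St ct]]] := real o oF; rewrite e1 in ct.
  have [S1 [c1 [cW1 agr1 S1v c1v]]] := color_path_vertex e_sym e_irr cW WV n1W tW n2W nb1 St ct u1P.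
  have W1V : v1 |: W \subset V by rewrite subUset sub1set v1V.
  have n2W1 : v2 \notin v1 |: W by rewrite !inE negb_or eq_sym v12.
  have n3W1 : v3 \notin v1 |: W by rewrite !inE negb_or eq_sym v13.
  have S1i : S1 v1 =i u1 by rewrite S1v.
  have [S2 [c2 [cW2 agr2 S2v c2v]]] :=
    color_path_vertex e_sym e_irr cW1 W1V n2W1 (setU11 _ _) n3W1 nb2 S1i c1v u2P.
  exists S2, c2; split=> // x xW0; have xW := subsetP W0W _ xW0.
  have [-> ->] := agr2 x (setU1r _ xW); have [-> ->] := agr1 x xW; exact: agr.
have n3W2 : v3 \notin v2 |: (v1 |: W) by rewrite !inE !negb_or eq_sym v23 eq_sym v13.
have W2V : v2 |: (v1 |: W) \subset V by rewrite !subUset !sub1set v2V v1V.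
have [Z3|Z3] := boolP (Z v3).
  have l0 : l = [::] by move: fl; rewrite /= Z1 Z2 Z3; case: (l).
  rewrite l0 /= andbT in pl Wl; move/eqP in pl.
  have sW : s \in W := subsetP W0W _ sW0.
  have [_ e3s] := nxC v3 C3; rewrite pl in e3s.
  have nb3 y : y \in V -> e v3 y -> y = v2 \/ y = s.
    by have := hZ v2 y C2; rewrite e3 pl; exact.
  have n3W0 : v3 \notin W0 by apply: contra n3W; exact: (subsetP W0W).
  have [|s' s'z [s'h s'i]] := @pending s v3 sW0 v3V n3W0; first by rewrite e_sym.
  have /allP/(_ s' s'z)/hasP[st oF /hasP[u1 u1P /hasP[u2 u2P /hasP[u3 u3P /andP[/eqP hu3 co]]]]] :=
    allP color_end F FF.
  have [S [c [cW agr Sv cv]]] := add12 st u1 u2 oF u1P u2P.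
  have [Ss cs] := agr s sW0.
  have Svi : S v2 =i u2 by rewrite Sv.
  have Ssi : S s =i s' by rewrite Ss.
  have csv : c s v3 = head 0 s' by rewrite cs.
  have sW2 : s \in v2 |: (v1 |: W) by rewrite !inE sW !orbT.
  have sv2 : s != v2 by apply: contraNneq n2W => <-.
  have [S3 [c3 col3]] := color_last_vertex e_sym e_irr cW W2V n3W2 (setU11 _ _) sW2 sv2 nb3 Svi cv Ssi csv u3P hu3 co.
  suff eqV : v3 |: (v2 |: (v1 |: W)) = V by rewrite eqV in col3; exists S3, c3.
  apply/setP => y; rewrite !inE; have [yV|yV] := boolP (y \in V).
    by have := Wl y yV; rewrite !inE => ->; case: (y == v1); case: (y == v2); case: (y == v3).
  apply/negbTE; rewrite !negb_or; apply/and4P; split; try by apply: contraNneq yV => ->.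
  by apply: contra yV; exact: (subsetP WV).
have fl' : fillable (map Z l) by move: fl; rewrite /= Z1 Z2 (negPf Z3).
have [q [l' [eqq nq]]] : exists q l', rcons l s = q :: l' /\ q \in l.
  by case: (l) fl' => // q l' _; exists q, (rcons l' s); rewrite mem_head.
have nx3 : nx v3 = q by move: pl; rewrite eqq /= => /andP[/eqP].
have [x [xV xC v3x nb3]] : exists x, [/\ x \in V, x \notin C, e v3 x &
     forall y, y \in V -> e v3 y -> [\/ y = v2, y = q | y = x]].
  by have := hB v2 C2; rewrite e3 nx3; apply.
have xW0 : x \in W0 := outC x xV xC.
have xW : x \in W := subsetP W0W _ xW0.
have n3W0 : v3 \notin W0 by apply: contra n3W; exact: (subsetP W0W).
have [|s' s'z [s'h s'i]] := @pending x v3 xW0 v3V n3W0; first by rewrite e_sym.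
have /allP/(_ s' s'z)/hasP[F' F'F /allP F'P] := allP color_step F FF.
have qV : q \in V by apply: lV; rewrite !inE nq !orbT.
have nqW : q \notin W by rewrite Wl // !inE nq !orbT.
have nqW2 : q \notin v2 |: (v1 |: W).
  rewrite !inE !negb_or nqW andbT; apply/andP; split; first by apply: contraNneq v2l => <-.
  by apply: contraNneq v1l => <-.
have xW2 : x \in v2 |: (v1 |: W) by rewrite !inE xW !orbT.
have xv2 : x != v2 by apply: contraNneq n2W => <-.
apply: (IHn l _ v3 s (v3 |: (v2 |: (v1 |: W))) F') => //.
- exact: (leq_trans (leqW (leqW (leqnn _))) sl).
- by rewrite !inE eqxx.
- by apply: subset_trans W0W _; apply/subsetP => y yW; rewrite !inE yW !orbT.
- by rewrite subUset sub1set v3V.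
- move=> y yV; have := Wl y yV; rewrite !inE => ->.
  have [->|_] := eqVneq y v1; first by rewrite v1l /= !orbT.
  have [->|_] := eqVneq y v2; first by rewrite v2l /= ?orbT.
  by have [->|_] := eqVneq y v3; rewrite ?v3l.
- by move=> y yl; apply: lV; rewrite !inE yl !orbT.
move=> o /F'P/flattenP[_ /mapP[st stF ->] /flattenP[_ /mapP[u2 /flattenP[_ /mapP[u1 u1P ->] u2P] ->] oP]].
have [S [c [cW agr Sv cv]]] := add12 st u1 u2 stF u1P u2P.
have [Sx cx] := agr x xW0.
have Svi : S v2 =i u2 by rewrite Sv.
have Sxi : S x =i s' by rewrite Sx.
have cxv : c x v3 = head 0 s' by rewrite cx.
have [S3 [c3 [col3 agr3 S3v c3v]]] := color_branch_vertex e_sym e_irr cW W2V n3W2 (setU11 _ _) xW2 xv2 nqW2 nb3 Svi cv Sxi cxv oP.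
exists S3, c3; split=> //.
- move=> y yW0; have yW : y \in W := subsetP W0W _ yW0.
  by have [-> ->] := agr3 y (setU1r _ (setU1r _ yW)); exact: agr.
- by rewrite S3v.
- by rewrite nx3.
Qed.

(** A path that cannot be extended inside [X] closes up at its newest vertex, and a path cannot grow
    beyond #|X| vertices. *)
Lemma cycle_of_min_degree2 (T : finType) (e : rel T) (e_sym : symmetric e) (e_irr : irreflexive e) (X : {set T}) :
  X != set0 -> (forall x, x \in X -> 2 <= #|[set y in X | e x y]|) ->
  exists c, [/\ cycle e c, uniq c, 2 < size c & {subset c <= X}].
Proof.
move=> /set0Pn[x0 x0X] deg2.
have grow n : (exists c, [/\ cycle e c, uniq c, 2 < size c & {subset c <= X}]) \/
    exists x p, [/\ path e x p, uniq (x :: p), {subset x :: p <= X} & size p = n].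
  elim: n => [|n [h|[x [p [ep up pX sp]]]]].
  - by right; exists x0, [::]; split=> // y; rewrite inE => /eqP ->.
  - by left.
  have xX : x \in X by apply: pX; exact: mem_head.
  have [/existsP[y /and3P[yX xy yp]]|] := boolP [exists y, [&& y \in X, e x y & y \notin x :: p]].
    right; exists y, (x :: p); split=> /=; last by rewrite sp.
    - by rewrite e_sym xy.
    - by rewrite yp.
    - by move=> z; rewrite inE => /predU1P[->//|/pX].
  rewrite negb_exists => /forallP nbp; left.
  have {}nbp y : y \in X -> e x y -> y \in p.
    move=> yX xy; have := nbp y; rewrite yX xy /= negbK inE => /predU1P[yx|//].
    by rewrite yx e_irr in xy.
  (* The newest vertex comes first, so [head x p] is its predecessor on the path; avoiding it makes
     the cycle longer than 2. *)
  have [y yX [xy yh]] : exists2 y, y \in X & e x y /\ y != head x p.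
    have : 0 < #|[set y in X | e x y] :\ head x p|.
      by have := deg2 x xX; rewrite (cardsD1 (head x p)); case: (_ \in _); rewrite // add0n => /ltnW.
    by case/card_gt0P=> y; rewrite !inE => /and3P[yh yX xy]; exists y.
  have yp := nbp y yX xy.
  case/splitPr: yp ep up pX yh {sp nbp} => p1 p2 ep up pX yh.
  exists (x :: rcons p1 y); split.
  - move: ep; rewrite cat_path /= => /and3P[e1 e2 _].
    by rewrite !rcons_path e1 e2 last_rcons e_sym.
  - by move: up; rewrite -cat_rcons -cat_cons cat_uniq => /and3P[].
  - by case: p1 yh {ep up pX} => [|? ?]; rewrite /= ?eqxx // size_rcons.
  - move=> z zc; apply: pX; move: zc; rewrite !inE mem_rcons mem_cat !inE.
    by case/or3P=> ->; rewrite ?orbT.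
have [//|[x [p [_ up pX sp]]]] := grow #|X|.
suff : size (x :: p) <= size (enum X) by rewrite -cardE /= sp ltnn.
by apply: uniq_leq_size => // z /pX; rewrite mem_enum.
Qed.

Definition chordless (T : finType) (e : rel T) (c : seq T) : bool :=
  [forall u, forall v, [&& u \in c, v \in c & e u v] ==> (v == next c u) || (u == next c v)].

Lemma chordless_cycle (T : finType) (e : rel T) (e_sym : symmetric e) (e_irr : irreflexive e) (c : seq T) :
  cycle e c -> uniq c -> 2 < size c ->
  exists c', [/\ cycle e c', uniq c', 2 < size c', {subset c' <= c} & chordless e c'].
Proof.
move: {2}(size c).+1 (ltnSn (size c)) => n; elim: n c => // n IHn c sc ec uc c3.
have [ch|] := boolP (chordless e c); first by exists c; split.
rewrite negb_forall => /existsP[u]; rewrite negb_forall => /existsP[v].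
rewrite negb_imply negb_or => /andP[/and3P[uin vin uv] /andP[vu1 uv1]].
have [i s eqc] := rot_to uin.
have es : cycle e (u :: s) by rewrite -eqc rot_cycle.
have us : uniq (u :: s) by rewrite -eqc rot_uniq.
have sub : {subset u :: s <= c} by move=> x; rewrite -eqc mem_rot.
have ss : size (u :: s) = size c by rewrite -eqc size_rot.
rewrite -(next_rot i uc) eqc in vu1; rewrite -(next_rot i uc) eqc in uv1.
have vs : v \in s.
  have : v \in u :: s by rewrite -eqc mem_rot.
  by rewrite inE => /predU1P[vu|//]; rewrite vu e_irr in uv.
case/splitPr: vs es us sub ss vu1 uv1 {eqc} => p1 p2 es us sub ss vu1 uv1.
have p1n : p1 != [::] by apply: contraNneq vu1 => ->; rewrite /= eqxx.
have p2n : p2 != [::].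
  apply: contraNneq uv1 => p20; have nv : next (u :: p1 ++ v :: p2) v = u.
    by rewrite -(next_rot (size (u :: p1)) us) p20 -cat_cons rot_size_cat /= eqxx.
  by rewrite nv.
have [||||c' [ec' uc' c3' sub' ch']] := IHn (u :: rcons p1 v).
- rewrite /= size_rcons; move: sc; rewrite -ss /= size_cat /=; case: (p2) p2n => //= a p _.
  by rewrite !addnS !ltnS => h; apply: leq_trans h; rewrite ltnS leq_addr.
- move: es; rewrite /= !rcons_path cat_path /= => /andP[/and3P[e1 e2 _] _].
  by rewrite e1 e2 last_rcons e_sym.
- by move: us; rewrite -cat_rcons -cat_cons cat_uniq => /and3P[].
- by rewrite /= size_rcons; case: (p1) p1n.
exists c'; split=> // x /sub' xc; apply: sub; move: xc; rewrite !inE mem_rcons mem_cat !inE.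
by case/or3P=> ->; rewrite ?orbT.
Qed.

Definition swap (T : eqType) (a b : T) : T -> T := fun x => if x == a then b else if x == b then a else x.

Lemma swapK (T : eqType) (a b : T) : involutive (swap a b).
Proof.
move=> x; rewrite /swap; have [->|xa] := eqVneq x a.
  by rewrite eqxx; case: eqVneq.
by have [->|xb] := eqVneq x b; rewrite ?eqxx // (negPf xa) (negPf xb).
Qed.

(** Neither edge has a coloured far end, so exchanging their reserved colours leaves the palette of
    [b] and all compatibilities intact. *)
Lemma swap_pending (T : finType) (e : rel T) (V W : {set T}) (S : T -> seq nat) (c : T -> T -> nat) (b y1 y2 : T) :
  partial_coloring e V W S c -> y1 \in V -> y2 \in V -> y1 \notin W -> y2 \notin W -> e b y1 -> e b y2 ->
  partial_coloring e V W S (upd c b (fun y => c b (swap y1 y2 y))).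
Proof.
move=> [SP cS cinj cE] y1V y2V y1W y2W by1 by2; rewrite /upd.
have sV y : y \in V -> swap y1 y2 y \in V by rewrite /swap; do 2?case: ifP.
have se y : e b y -> e b (swap y1 y2 y) by rewrite /swap; do 2?case: ifP.
have sW y : y \in W -> swap y1 y2 y = y.
  rewrite /swap; case: eqP => [->|_]; first by rewrite (negPf y1W).
  by case: eqP => [->|//]; rewrite (negPf y2W).
split=> //.
- move=> x y xW yV xy; have [xb|_] := eqVneq x b; last exact: cS.
  by rewrite xb in xW xy *; apply: cS; [|exact: sV|exact: se].
- move=> x y z xW yV zV xy xz; have [xb|_] := eqVneq x b; last exact: cinj.
  rewrite xb in xW xy xz *; move/(cinj b _ _ xW (sV _ yV) (sV _ zV) (se _ xy) (se _ xz)).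
  exact: (can_inj (swapK y1 y2)).
- move=> x y xW yW xy; rewrite (_ : (if x == b then _ else _) y = c x y).
    rewrite (_ : (if y == b then _ else _) x = c y x); first exact: cE.
    by case: eqP => [->|//]; rewrite sW.
  by case: eqP => [->|//]; rewrite sW.
Qed.

Lemma single_family (s : seq nat) : s \in zstates -> head 0 s != 0 -> [:: s] \in families.
Proof.
by move=> sz s0; rewrite mem_cat; apply/orP; left; apply/mapP; exists s; rewrite // mem_filter s0.
Qed.

Lemma next_next (T : eqType) (c : seq T) (p : T) : uniq c -> 2 < size c -> p \in c ->
  next c (next c p) != p.
Proof.
move=> uc sc /rot_to[i s eqs]; rewrite -!(next_rot i uc) eqs.
have : uniq (rot i c) by rewrite rot_uniq.
have : 2 < size (rot i c) by rewrite size_rot.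
rewrite eqs; case: s {eqs} => [|a [|b s]] //= _ /andP[]; rewrite !inE !negb_or => /and3P[pa pb _] _.
by rewrite !eqxx (negPf (_ : a != p)) 1?eq_sym.
Qed.

Lemma next_inj (T : eqType) (c : seq T) : uniq c -> injective (next c).
Proof. by move=> uc; exact: can_inj (prev_next uc). Qed.

Lemma reducible_cycle (T : finType) (e : rel T) (e_sym : symmetric e) (e_irr : irreflexive e)
    (V : {set T}) (c : seq T) :
  (forall x, x \in V -> 2 <= #|[set y in V | e x y]| <= 3) ->
  (forall W : {set T}, W \proper V -> colorable e W) ->
  cycle e c -> uniq c -> 4 < size c -> {subset c <= V} -> chordless e c ->
  3 * count (fun x => #|[set y in V | e x y]| != 2) c < size c ->
  colorable e V.
Proof.
move=> deg IH ec uc c5 cV ch cnt.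
have c3 : 2 < size c by apply: leq_trans c5.
pose Z x := #|[set y in V | e x y]| == 2; pose nx := next c; pose C := [set x in c].
have nxC p : p \in C -> nx p \in C /\ e p (nx p).
  by rewrite !inE => pc; split; [rewrite mem_next|exact: next_cycle].
have nbs p : p \in C -> [/\ nx p \in V, p \in V, e (nx p) p & [/\ e (nx p) (nx (nx p)), nx (nx p) \in V & nx (nx p) != p]].
  have CV x : x \in C -> x \in V by rewrite inE; exact: cV.
  move=> pC; have [nC pn] := nxC p pC; have [nnC pnn] := nxC _ nC.
  split; [exact: CV|exact: CV|by rewrite e_sym|split=> //; first exact: CV].
  by apply: next_next => //; move: pC; rewrite inE.
have sub2 p : p \in C -> [set p; nx (nx p)] \subset [set y in V | e (nx p) y].
  move=> /nbs[_ pV np [nnn nnV _]]; apply/subsetP => y; rewrite !inE.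
  by case/orP=> /eqP->; rewrite ?pV ?nnV.
have card2 p : p \in C -> #|[set p; nx (nx p)]| = 2.
  by move=> /nbs[_ _ _ [_ _ nnp]]; rewrite cards2 eq_sym nnp.
have hZ p y : p \in C -> Z (nx p) -> y \in V -> e (nx p) y -> y = p \/ y = nx (nx p).
  move=> pC /eqP Zp yV ny; have /eqP eqN : [set p; nx (nx p)] == [set y in V | e (nx p) y].
    by rewrite eqEcard sub2 // card2 // Zp.
  have : y \in [set p; nx (nx p)] by rewrite eqN inE yV.
  by rewrite !inE => /orP[/eqP->|/eqP->]; [left|right].
have hB p : p \in C -> ~~ Z (nx p) -> exists x, [/\ x \in V, x \notin C, e (nx p) x &
     forall y, y \in V -> e (nx p) y -> [\/ y = p, y = nx (nx p) | y = x]].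
  move=> pC Zp; have [nV pV np [nnn nnV nnp]] := nbs p pC.
  have c1 : #|[set y in V | e (nx p) y] :\: [set p; nx (nx p)]| = 1.
    rewrite cardsD (setIidPr (sub2 p pC)) card2 //.
    by move: (deg _ nV) Zp; rewrite /Z; case: #|_| => [|[|[|[|]]]].
  have /cards1P[x eqx] : #|[set y in V | e (nx p) y] :\: [set p; nx (nx p)]| == 1 by apply/eqP.
  have : x \in [set y in V | e (nx p) y] :\: [set p; nx (nx p)] by rewrite eqx inE.
  rewrite !inE negb_or => /and3P[/andP[xp xn] xV nxx]; exists x; split=> //.
    apply/negP; rewrite inE => xc; have [nC _] := nxC p pC; rewrite inE in nC.
    (* The third neighbour is off the cycle since the cycle has no chord; hence it is coloured
       throughout the recolouring. *)
    have /forallP/(_ (nx p))/forallP/(_ x) := ch; rewrite nC xc nxx /= => /orP[/eqP h|/eqP h].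
      by rewrite h eqxx in xn.
    by rewrite (next_inj uc h) eqxx in xp.
  move=> y yV ny; have [->|yp] := eqVneq y p; first exact: Or31.
  have [->|yn] := eqVneq y (nx (nx p)); first exact: Or32.
  suff : y \in [set x] by rewrite inE => /eqP ->; exact: Or33.
  by rewrite -eqx !inE negb_or yp yn yV.
have cntw : 2 * count negb (map Z c) < count id (map Z c).
  have := count_predC Z c; rewrite !count_map.
  rewrite (_ : count (preim Z negb) c = count (predC Z) c) // (_ : count (preim Z id) c = count Z c) //.
  rewrite (_ : count (predC Z) c = count (fun x => #|[set y in V | e x y]| != 2) c) //.
  move: cnt; move: (count _ c) (count _ c) (size c) => a b n; lia.
pose Q w := exists i, w = map Z (rot i c).
have Qrot w i : Q w -> Q (rot i w).
  by move=> [j ->]; exists (rot_add c j i); rewrite -map_rot rot_rot_add.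
have [||w1 [fw hw]] := cyclic_word Qrot _ _ cntw; [by exists 0; rewrite rot0|by rewrite size_map|].
have pathc i : forall t r, rot i c = t :: r -> path (frel nx) t (rcons r t).
  move=> t r eqr; have : fcycle (next (rot i c)) (rot i c) by rewrite cycle_next ?rot_uniq.
  by rewrite eqr /= -eqr (eq_path (e' := frel nx)) // => x y; rewrite /= next_rot.
have rotC i : rot i c =i C by move=> x; rewrite mem_rot inE.
have uqr i : uniq (rot i c) by rewrite rot_uniq.
have CV x : x \in C -> x \in V by rewrite inE; exact: cV.
have IHs (l : seq T) (b : T) : b \in l -> {subset l <= V} ->
    exists S c, partial_coloring e V (V :\: [set x in l]) S c /\
      forall x y, x \in V :\: [set x in l] -> y \in V -> y \notin V :\: [set x in l] -> e x y -> 0 \in S x.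
  move=> bl lV; have [|S [c0 col]] := IH (V :\: [set x in l]).
    by apply/properP; split; [exact: subsetDl|exists b; [exact: lV|rewrite !inE bl]].
  apply: reserve_colors col _ _ => //; first exact: subsetDl.
  by move=> x /setDP[/deg/andP[]].
case: hw => [[tb [rb [i]]]|[i]].
  case eqr: (rot i c) => [|t [|u0 c'']] //= [_ /esym Zu eqw].
  pose l := take (size w1) c''; pose r := drop (size w1) c''.
  have eqc'' : c'' = l ++ r by rewrite cat_take_drop.
  have Zl : map Z l = w1 by rewrite map_take -eqw take_size_cat.
  (* If [r] is empty, the segment comes back to [t], whence the default value of [head]. *)
  rewrite -Zl in fw; pose s := head t r.
  have [pth nxt] : path (frel nx) u0 (rcons l s) /\ nx t = u0.
    have := pathc i _ _ eqr; rewrite /= => /andP[/eqP nt]; rewrite eqc'' rcons_cat cat_path => /andP[p1 p2].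
    split=> //; rewrite rcons_path p1 /=; move: p2; rewrite /s; case: (r) => [|a r'] /=; by case/andP.
  have := uqr i; rewrite eqr /= inE negb_or => /and3P[/andP[tu tc] uc'' uqc].
  have memC x : x \in [:: t, u0 & c''] -> x \in C by rewrite -eqr rotC.
  have tC : t \in C by apply: memC; rewrite mem_head.
  have uC : u0 \in C by apply: memC; rewrite !inE eqxx orbT.
  have lC x : x \in l -> x \in C by move=> xl; apply: memC; rewrite eqc'' !inE mem_cat xl !orbT.
  have tl : t \notin l by apply: contra tc; rewrite eqc'' mem_cat => ->.
  have ul : u0 \notin l by apply: contra uc''; rewrite eqc'' mem_cat => ->.
  have uql : uniq l by move: uqc; rewrite eqc'' cat_uniq => /and3P[].
  have [|x|S0 [c0 [col norm]]] := IHs (u0 :: l) u0; first exact: mem_head.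
    by rewrite inE => /predU1P[->|/lC] ; exact: CV.
  set W0 := V :\: _ in col norm.
  have W0E x : x \in V -> (x \in W0) = (x \notin u0 :: l) by move=> xV; rewrite !inE xV andbT.
  have W0V : W0 \subset V by exact: subsetDl.
  have tW0 : t \in W0 by rewrite W0E ?CV // inE negb_or tu.
  have uW0 : u0 \notin W0 by rewrite !inE eqxx.
  have [S0P c0S _ _] := col.
  have etu : e t u0 by rewrite -nxt; have [] := nxC t tC.
  have [st stz [sth sti]] : exists2 s', s' \in zstates & head 0 s' = c0 t u0 /\ S0 t =i s'.
    by apply: palette_head; [exact: S0P|exact: norm tW0 (CV _ uC) uW0 etu|apply: c0S => //; exact: CV].
  have /hasP[su suP /andP[su0 suh]] := allP color_start st stz.
  have nul : nx u0 \in l.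
    by move: fw pth; case: (l) => // q l' _ /= /andP[/eqP -> _]; exact: mem_head.
  have nuW0 : nx u0 \notin W0 by rewrite !inE nul orbT.
  have nbu y : y \in V -> e u0 y -> y = t \/ y = nx u0.
    by have := hZ t y tC; rewrite nxt; apply.
  have [S [c1 [col1 agr Su cu]]] :=
    color_path_vertex e_sym e_irr col W0V uW0 tW0 nuW0 nbu sti (esym sth) suP.
  apply: (fill_path e_sym e_irr col norm nxC hZ hB _ fw pth uC (setU11 u0 W0) _ _ uql _ _ _ (F := [:: su])).
  - by move=> x xV xC; rewrite W0E //; apply: contra xC; rewrite inE => /predU1P[->|/lC].
  - exact: subsetUr.
  - by rewrite subUset sub1set CV.
  - move=> x xV; rewrite in_setU1 W0E // inE negb_or; have [->|] := eqVneq x u0; by rewrite ?ul.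
  - by move=> x /lC/CV.
  - rewrite W0E; last by apply: CV; rewrite /s; case eqr' : r => [|a r'] //=; apply: memC; rewrite eqc'' eqr' !inE mem_cat mem_head !orbT.
    rewrite /s; case eqr' : r => [|a r'] /=; first by rewrite inE negb_or tu.
    move: uc'' uqc; rewrite eqc'' eqr' mem_cat cat_uniq !inE !negb_or => /and3P[_ ua _] /and3P[_ /andP[al _] _].
    by rewrite eq_sym ua.
  - apply: single_family => //; have [suPl _ _] := extsP suP; by rewrite mem_filter su0.
  - by move=> o; rewrite inE => /eqP ->; exists S, c1; split=> //; rewrite Su.
case eqr: (rot i c) => [|b l] //= [/esym Zb eqw].
rewrite eqw in fw.
have pth : path (frel nx) b (rcons l b) by exact: pathc eqr.
have := uqr i; rewrite eqr /= => /andP[bl uql].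
have memC x : x \in b :: l -> x \in C by rewrite -eqr rotC.
have bC : b \in C by apply: memC; exact: mem_head.
have lC x : x \in l -> x \in C by move=> xl; apply: memC; rewrite inE xl orbT.
have [nbC bnb] := nxC b bC.
have nbl : nx b \in l.
  by move: fw pth; case: (l) => // q l' _ /= /andP[/eqP -> _]; exact: mem_head.
pose y2 := last b l.
have y2l : y2 \in l by rewrite /y2; case: (l) fw => // a l' _; rewrite /= mem_last.
have ny2 : nx y2 = b by move: pth; rewrite rcons_path => /andP[_ /eqP].
have by2 : e b y2 by rewrite e_sym -ny2; have [] := nxC y2 (lC _ y2l); rewrite ny2.
have y2n : y2 != nx b by apply: contraTneq (next_next uc c3 (_ : b \in c)) => [y2E|]; [rewrite -/nx -y2E ny2 eqxx|move: bC; rewrite inE].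
have lV : {subset l <= V} by move=> x /lC/CV.
have [S0 [c1 [col1 norm]]] := IHs l (nx b) nbl lV.
set W0 := V :\: _ in col1 norm.
have W0E x : x \in V -> (x \in W0) = (x \notin l) by move=> xV; rewrite !inE xV andbT.
have bW0 : b \in W0 by rewrite W0E // CV.
have y2W0 : y2 \notin W0 by rewrite W0E ?negbK // lV.
have nbW0 : nx b \notin W0 by rewrite W0E ?negbK // lV.
(* Here [b] is the only coloured vertex of the cycle and no starting vertex is available. Its two
   pending edges have distinct colours, so one is not 0, and a swap puts it on the edge to
   [nx b]. *)
have [c0 [col0 cb0]] : exists c0, partial_coloring e V W0 S0 c0 /\ c0 b (nx b) != 0.
  have [cb0|] := eqVneq (c1 b (nx b)) 0; last by exists c1.
  exists (upd c1 b (fun y => c1 b (swap (nx b) y2 y))); split.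
    by apply: swap_pending => //; exact: lV.
  rewrite /upd eqxx /swap eqxx; apply: contraNneq y2n => cb2.
  have [_ _ inj _] := col1; apply/eqP; apply: (inj b y2 (nx b)) => //; rewrite ?lV //.
  by rewrite cb2 cb0.
have [S0P c0S _ _] := col0.
have [sb sbz [sbh sbi]] : exists2 s', s' \in zstates & head 0 s' = c0 b (nx b) /\ S0 b =i s'.
  apply: palette_head; [exact: S0P|exact: norm bW0 (lV _ nbl) nbW0 bnb|apply: c0S => //; exact: lV].
apply: (fill_path e_sym e_irr col0 norm nxC hZ hB _ fw pth bC bW0 _ _ uql W0E lV bW0 (F := [:: sb])) => //.
- by move=> x xV xC; rewrite W0E //; apply: contra xC; exact: lC.
- exact: subsetDl.
- by apply: single_family => //; rewrite sbh.
- by move=> o; rewrite inE => /eqP ->; exists S0, c0; split.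
Qed.

(** * Induction on the vertex set *)

Lemma colorable_leaf (T : finType) (e : rel T) (e_sym : symmetric e) (e_irr : irreflexive e)
    (V : {set T}) (v : T) :
  (forall x, x \in V -> #|[set y in V | e x y]| <= 3) -> v \in V ->
  #|[set y in V | e v y]| <= 1 -> colorable e (V :\ v) -> colorable e V.
Proof.
move=> deg3 vV deg1 [S [c col]].
have [|S0 [c0 [col0 norm]]] := reserve_colors e_sym col (subsetDl V [set v]).
  by move=> x /setD1P[_ /deg3].
have vW : v \notin V :\ v by rewrite !inE eqxx.
suff [S1 [c1 col1]] : exists S1 c1, partial_coloring e V (v |: V :\ v) S1 c1.
  by rewrite setD1K // in col1; exists S1, c1.
have [N0|[p]] := set_0Vmem [set y in V | e v y].
  have noN y : y \in V -> e v y -> False.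
    by move=> yV vy; have := in_set0 y; rewrite -N0 inE yV vy.
  exists (upd S0 v [:: 0; 1; 2]), (upd c0 v (fun=> 0)).
  apply: color_vertex => //.
  - by move=> y z yV _ vy; case: (noN y yV vy).
  - by move=> y /setD1P[_ yV] vy; case: (noN y yV vy).
rewrite inE => /andP[pV vp].
have Np y : y \in V -> e v y -> y = p.
  move=> yV vy; apply: contraTeq deg1 => yp; rewrite -ltnNge.
  have <- : #|[set y; p]| = 2 by rewrite cards2 yp.
  by apply/subset_leq_card/subsetP => z; rewrite !inE => /orP[]/eqP->; rewrite ?yV ?pV.
have pW : p \in V :\ v by rewrite !inE pV andbT; apply: contraTneq vp => ->; rewrite e_irr.
have [S0P c0S _ _] := col0; have pv : e p v by rewrite e_sym.
have [s sz [sh si]] : exists2 s', s' \in zstates & head 0 s' = c0 p v /\ S0 p =i s'.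
  by apply: palette_head; [exact: S0P|exact: norm pW vV vW pv|exact: c0S].
have /hasP[t tP _] := allP color_start s sz.
(* A leaf has no onward edge; [v] itself takes the place of the uncoloured successor [q]. *)
have [|S1 [c1 [col1 _ _ _]]] := color_path_vertex e_sym e_irr col0 (subsetDl _ _) vW pW vW _ si (esym sh) tP.
  by move=> y yV /(Np y yV) ->; left.
by exists S1, c1.
Qed.

Lemma sparse_colorable (T : finType) (e : rel T) (e_sym : symmetric e) (e_irr : irreflexive e) :
  (forall x, #|[set y | e x y]| <= 3) ->
  (forall c, cycle e c -> uniq c -> 2 < size c -> 16 <= size c) ->
  (forall V : {set T}, V != set0 -> (forall x, x \in V -> 2 <= #|[set y in V | e x y]| <= 3) ->
     exists X : {set T}, [/\ X != set0, X \subset V, forall x, x \in X -> 2 <= #|[set y in X | e x y]| &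
       #|[set x in X | #|[set y in V | e x y]| == 3]| <= 5]) ->
  forall V : {set T}, colorable e V.
Proof.
move=> deg3 girth sparse V.
have deg3V (U : {set T}) x : #|[set y in U | e x y]| <= 3.
  by apply: leq_trans (deg3 x); apply/subset_leq_card/subsetP => y; rewrite !inE => /andP[].
move: {2}#|V|.+1 (ltnSn #|V|) => n; elim: n V => // n IHn V Vn.
have IH (W : {set T}) : W \proper V -> colorable e W.
  by move=> /proper_card WV; apply: IHn; exact: leq_trans WV _.
have [->|V0] := eqVneq V set0.
  by exists (fun=> [::]), (fun _ _ => 0); split=> [x|x y|x y z|x y]; rewrite inE.
have [/existsP[v /andP[vV v1]]|] := boolP [exists v, (v \in V) && (#|[set y in V | e v y]| <= 1)].
  by apply: (colorable_leaf e_sym e_irr _ vV v1) => //; apply: IH; exact: properD1.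
rewrite negb_exists => /forallP deg2.
have deg x : x \in V -> 2 <= #|[set y in V | e x y]| <= 3.
  by move=> xV; have := deg2 x; rewrite xV /= -ltnNge deg3V andbT.
have [X [X0 XV X2 X5]] := sparse V V0 deg.
have [c0 [ec0 uc0 sc0 c0X]] := cycle_of_min_degree2 e_sym e_irr X0 X2.
have [c [ec uc sc cc0 ch]] := chordless_cycle e_sym e_irr ec0 uc0 sc0.
have c16 := girth c ec uc sc.
have cX : {subset c <= X} by move=> x /cc0/c0X.
apply: (reducible_cycle e_sym e_irr deg IH ec uc _ _ ch).
- by apply: leq_trans c16.
- by move=> x /cX; exact: (subsetP XV).
apply: leq_trans c16; rewrite ltnS -[15]/(3 * 5) leq_mul2l /=.
apply: leq_trans X5; rewrite -size_filter cardE; apply: uniq_leq_size; first exact: filter_uniq.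
move=> x; rewrite mem_filter mem_enum inE => /andP[x2 /cX xX]; rewrite xX /=.
by have := deg x (subsetP XV _ xX); move: x2; case: #|_| => [|[|[|[|]]]].
Qed.

Lemma grid_drawing_sub (T : finType) (e e' : rel T) (n : nat) (root : T -> nat * nat)
    (W : T -> T -> seq (nat * nat)) :
  subrel e' e -> is_grid_drawing e n root W -> is_grid_drawing e' n root W.
Proof.
move=> sub [h1 h2 h3 h4 h5]; split.
- by move=> u v /sub; exact: h1.
- by move=> u v /sub; exact: h2.
- by move=> u v p /sub; exact: h3.
- by move=> u v u' v' p /sub uv /sub; exact: h4.
- by move=> u v w /sub; exact: h5.
Qed.

(** The same walks draw the subgraph induced on [V]; keeping the type [T] merely makes the other
    vertices isolated. *)
Lemma grid_drawing_sparse (T : finType) (e : rel T) (e_sym : symmetric e) (e_irr : irreflexive e)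
    (n : nat) (root : T -> nat * nat) (W : T -> T -> seq (nat * nat)) (V : {set T}) :
  is_grid_drawing e n root W ->
  V != set0 -> (forall x, x \in V -> 2 <= #|[set y in V | e x y]| <= 3) ->
  exists X : {set T}, [/\ X != set0, X \subset V, forall x, x \in X -> 2 <= #|[set y in X | e x y]| &
    #|[set x in X | #|[set y in V | e x y]| == 3]| <= 5].
Proof.
move=> dr /set0Pn[x0 x0V] deg; pose eV := [rel x y | [&& x \in V, y \in V & e x y]].
have eV_sym : symmetric eV by move=> x y; rewrite /= e_sym andbCA.
have eV_irr : irreflexive eV by move=> x; rewrite /= e_irr !andbF.
have eVe : subrel eV e by move=> x y /and3P[].
have [Q [F Fml]] := grid_drawing_maclane eV_sym eV_irr (grid_drawing_sub eVe dr).
have degE x : x \in V -> #|[set y | eV x y]| = #|[set y in V | e x y]|.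
  by move=> xV; apply: eq_card => y; rewrite !inE /= xV.
have [y0] : exists y0, y0 \in [set y in V | e x0 y].
  by apply/card_gt0P; have /andP[/ltnW] := deg x0 x0V.
rewrite inE => /andP[y0V xy0].
have xy0V : eV x0 y0 by rewrite /= x0V y0V.
have [|X [X0 X2 X5]] := maclane_light_face eV_sym eV_irr Fml xy0V.
  by move=> x y /and3P[xV _ _]; rewrite degE //; exact: deg.
have XV : X \subset V.
  apply/subsetP => x /X2 /ltnW /card_gt0P[y]; rewrite inE => /andP[_ /and3P[]//].
exists X; split=> //.
- move=> x xX; apply: leq_trans (X2 x xX) _; apply/subset_leq_card/subsetP => y.
  by rewrite !inE => /andP[-> /eVe].
- apply: leq_trans X5; apply/subset_leq_card/subsetP => x; rewrite !inE => /andP[xX].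
  by rewrite xX degE // (subsetP XV).
Qed.

(** * From arcs to the grid *)

Import Order.TTheory GRing.Theory Num.Theory.
Import numFieldNormedType.Exports.

Local Open Scope ring_scope.

(** The distance attains its minimum on the compact product. The norm of the plane is the maximum
    norm, which suits a square grid. *)
Lemma compact_separation (R : realType) (K L : set (R * R)) :
  compact K -> compact L -> (forall x, K x -> L x -> False) ->
  exists2 d : R, 0 < d &
    forall x y, K x -> L y -> ~ (`|x.1 - y.1| < d /\ `|x.2 - y.2| < d).
Proof.
move=> cK cL KL; have [KL0|KL0] := pselect ((K `*` L)%classic !=set0)%classic; last first.
  exists 1 => // x y Kx Ly; exfalso; apply: KL0; exists (x, y); by split.
have [|[a b] /set_mem[/= Ka Lb] min_ab] :=
    @compact_EVT_min _ R (fun z : (R * R) * (R * R) => `|z.1 - z.2|) _ KL0 (compact_setX cK cL).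
  apply: continuous_subspaceT => z; apply: cvg_norm; apply: cvgB; [exact: cvg_fst | exact: cvg_snd].
exists `|a - b|.
  rewrite normr_gt0 subr_eq0; apply/eqP => ab; apply: (KL a) => //; by rewrite ab.
move=> x y Kx Ly [lt1 lt2].
have := min_ab (x, y) (mem_set (conj Kx Ly)); rewrite /= leNgt => /negP; apply.
by rewrite prod_normE /= gt_max lt1.
Qed.

Definition round (R : realType) (h : R) (z : R * R) : int * int :=
  (Num.floor (z.1 / h), Num.floor (z.2 / h)).

Definition grid_adj (p q : int * int) : bool :=
  (p.1 == q.1) && ((q.2 == p.2 + 1) || (p.2 == q.2 + 1)) ||
  (p.2 == q.2) && ((q.1 == p.1 + 1) || (p.1 == q.1 + 1)).

Lemma floor_near (R : realType) (h x y : R) : 0 < h -> `|x - y| < h ->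
  [|| Num.floor (y / h) == Num.floor (x / h),
      Num.floor (y / h) == Num.floor (x / h) + 1 |
      Num.floor (x / h) == Num.floor (y / h) + 1].
Proof.
move=> h0 xyh; have /andP[x1 x2] := floor_itv (x / h); have /andP[y1 y2] := floor_itv (y / h).
have {xyh} : `|x / h - y / h| < 1.
  by rewrite -mulrBl normrM normfV (gtr0_norm h0) ltr_pdivrMr // mul1r.
rewrite ltr_norml => /andP[d1 d2].
move: x1 x2 y1 y2 d1 d2; set u := x / h; set v := y / h.
set a := Num.floor u; set b := Num.floor v; rewrite !intrD => x1 x2 y1 y2 d1 d2.
have ab : a < b + 2 by rewrite -(ltr_int R) intrD; lra.
have ba : b < a + 2 by rewrite -(ltr_int R) intrD; lra.
lia.
Qed.

Lemma floor_dist (R : realType) (h x y : R) : 0 < h -> `|x - y| < h ->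
  `|h * (Num.floor (x / h))%:~R - y| < 2 * h.
Proof.
move=> h0 xyh; have /andP[x1 x2] := floor_itv (x / h).
move: x1 x2 xyh; rewrite intrD -[leRHS]mulrC -[ltLHS]mulrC => x1 x2.
have {}x1 : h * (Num.floor (x / h))%:~R <= x.
  by move: x1; rewrite -(ler_pM2l h0) mulrA mulfV ?gt_eqF // mul1r.
have {}x2 : x < h * (Num.floor (x / h))%:~R + h.
  by move: x2; rewrite -(ltr_pM2l h0) mulrA mulfV ?gt_eqF // mul1r mulrDr mulr1.
by rewrite !ltr_norml => /andP[d1 d2]; apply/andP; split; lra.
Qed.

(** The factor 2: one mesh width is lost to rounding and one to the corner of a step, which mixes
    coordinates of two points of the curve. *)
Definition near_curve (R : realType) (h : R) (g : R -> R * R) (p : int * int) : Prop :=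
  exists2 t : R, `[0, 1]%classic t &
    `|h * p.1%:~R - (g t).1| < 2 * h /\ `|h * p.2%:~R - (g t).2| < 2 * h.

(* Moving first horizontally and then vertically. *)
Lemma round_step (R : realType) (h : R) (g : R -> R * R) (t t' : R) :
  0 < h -> `[0, 1]%classic t -> `[0, 1]%classic t' ->
  `|(g t).1 - (g t').1| < h -> `|(g t).2 - (g t').2| < h ->
  exists s, [/\ path grid_adj (round h (g t)) s,
    last (round h (g t)) s = round h (g t') &
    {in s, forall p, near_curve h g p}].
Proof.
move=> h0 It It' d1 d2; pose q : int * int := (Num.floor ((g t').1 / h), Num.floor ((g t).2 / h)).
have nq : near_curve h g q.
  exists t => //=; split; apply: floor_dist => //; first by rewrite distrC.
  by rewrite subrr normr0.
have nt : near_curve h g (round h (g t')).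
  by exists t' => //=; split; apply: floor_dist => //; rewrite subrr normr0.
have [s1 [p1 l1 n1]] : exists s, [/\ path grid_adj (round h (g t)) s,
    last (round h (g t)) s = q & {in s, forall p, near_curve h g p}].
  have /or3P[/eqP e|/eqP e|/eqP e] := floor_near h0 d1.
  - by exists [::]; split=> //=; rewrite /q e.
  - exists [:: q]; split=> //= [|p]; last by rewrite inE => /eqP->.
    by rewrite /grid_adj /= e !eqxx orbT.
  - exists [:: q]; split=> //= [|p]; last by rewrite inE => /eqP->.
    by rewrite /grid_adj /= e !eqxx !orbT.
have [s2 [p2 l2 n2]] : exists s, [/\ path grid_adj q s,
    last q s = round h (g t') & {in s, forall p, near_curve h g p}].
  have /or3P[/eqP e|/eqP e|/eqP e] := floor_near h0 d2.
  - by exists [::]; split=> //=; rewrite /round e.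
  - exists [:: round h (g t')]; split=> //= [|p]; last by rewrite inE => /eqP->.
    by rewrite /grid_adj /= e !eqxx.
  - exists [:: round h (g t')]; split=> //= [|p]; last by rewrite inE => /eqP->.
    by rewrite /grid_adj /= e !eqxx !orbT.
exists (s1 ++ s2); split; first by rewrite cat_path p1 l1.
  by rewrite last_cat l1.
by move=> p; rewrite mem_cat => /orP[/n1|/n2].
Qed.

(** The parameters whose rounded point can be reached by a walk along the curve form a nonempty,
    relatively open and closed subset of the connected interval [0, 1]. *)
Lemma curve_walk (R : realType) (h : R) (g : R -> R * R) :
  0 < h -> {within `[0, 1], continuous g}%classic ->
  exists s, [/\ path grid_adj (round h (g 0)) s,
    last (round h (g 0)) s = round h (g 1) &
    {in round h (g 0) :: s, forall p, near_curve h g p}].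
Proof.
move=> h0 cg; pose A : set R := `[0, 1]%classic.
pose reach t := exists s, [/\ path grid_adj (round h (g 0)) s,
    last (round h (g 0)) s = round h (g t) &
    {in s, forall p, near_curve h g p}].
have A0 : A 0 by rewrite /A /= in_itv /= lexx ler01.
have A1 : A 1 by rewrite /A /= in_itv /= lexx ler01.
have stepr t t' : A t -> A t' -> `|(g t).1 - (g t').1| < h ->
    `|(g t).2 - (g t').2| < h -> reach t -> reach t'.
  move=> At At' d1 d2 [s [p l n]].
  have [s' [p' l' n']] := round_step h0 At At' d1 d2.
  exists (s ++ s'); split; first by rewrite cat_path p l.
    by rewrite last_cat l.
  by move=> x; rewrite mem_cat => /orP[/n|/n'].
pose N t0 := [set t | A t -> `|(g t0).1 - (g t).1| < h /\ `|(g t0).2 - (g t).2| < h]%classic.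
have nN t0 : A t0 -> nbhs t0 (N t0).
  move=> At0; have /subspace_continuousP/(_ t0 At0) := cg.
  move=> /(_ (ball (g t0) h) (nbhsx_ballx _ _ h0)) H.
  have {}H : nbhs t0 [set t | A t -> ball (g t0) h (g t)]%classic := H.
  by apply: filterS H => t Bt At; have [] := Bt At; rewrite -!ball_normE.
have nI t0 : A t0 -> (N t0)^°%classic t0 by move=> /nN.
have eqB : ([set t | A t /\ reach t] = A)%classic.
  have := @segment_connected R 0 1; apply.
  - exists 0; split=> //; by exists [::].
  - exists (\bigcup_(t0 in [set t | A t /\ reach t]) (N t0)^°)%classic.
      by apply: bigcup_open => t0 _; exact: open_interior.
    apply/seteqP; split=> [t [At rt]|t [At [t0 [At0 rt0]]]] /=.
      by split=> //; exists t => //; exact: nI.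
    move=> /interior_subset /(_ At)[d1 d2]; split=> //; exact: (stepr t0).
  - exists (~` \bigcup_(t0 in [set t | A t /\ ~ reach t]) (N t0)^°)%classic.
      rewrite closedC; apply: bigcup_open => t0 _; exact: open_interior.
    apply/seteqP; split=> [t [At rt]|t [At nt]] /=.
      split=> // -[t0 [At0 rt0]] /interior_subset /(_ At)[d1 d2]; apply: rt0.
      by apply: (stepr t) => //; rewrite distrC.
    split=> //; apply: contrapT => rt; apply: nt; exists t => //; exact: nI.
have [_ [s [p l n]]] : [set t | A t /\ reach t]%classic 1 by rewrite eqB.
exists s; split=> // q; rewrite inE => /predU1P[->|/n //].
by exists 0 => //=; split; apply: floor_dist => //; rewrite subrr normr0.
Qed.

(** By injectivity, the half rooted at [u] avoids the other end of its edge. Distinct arcs meet only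
    at common ends, so halves with different roots can meet only within one edge. *)
Lemma half_arcs (R : realType) (T : finType) (e : rel T)
    (e_sym : symmetric e) (e_irr : irreflexive e) : planar R e ->
  exists (pt : T -> R * R) (eta : T -> T -> R -> R * R),
  [/\ forall u v, e u v -> {within `[0, 1], continuous (eta u v)}%classic,
      forall u v, e u v -> eta u v 0 = pt u,
      forall u v, e u v -> eta u v 1 = eta v u 1,
      forall u v u' v' t t', e u v -> e u' v' -> u != u' ->
        `[0, 1]%classic t -> `[0, 1]%classic t' -> eta u v t = eta u' v' t' ->
        u' = v /\ v' = u &
      forall u v w t, e v w -> u != v -> `[0, 1]%classic t -> pt u <> eta v w t].
Proof.
move=> [pt [arc [pt_inj arcP arc_pt arc_arc]]].
have /choice[gam gamP] (p : T * T) : exists gm : R -> R * R, e p.1 p.2 ->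
   [/\ {within `[0, 1], continuous gm}%classic,
        {in `[0, 1] &, injective gm},
        gm 0 = pt p.1, gm 1 = pt p.2 &
        arc [set p.1; p.2]%SET = (gm @` `[0, 1])%classic].
  have [ep|nep] := boolP (e p.1 p.2); last by exists (fun=> 0).
  by have [gm gmP] := arcP _ _ ep; exists gm.
pose lt (u v : T) := (enum_rank u < enum_rank v)%N.
have ltN (u v : T) : u != v -> lt v u = ~~ lt u v.
  move=> uv; rewrite /lt -leqNgt ltn_neqAle; suff -> : enum_rank v != enum_rank u :> nat by [].
  by apply: contra uv => /eqP/val_inj/enum_rank_inj->.
pose I01 (t : R) := `[0, 1]%classic t.
have I01E t : I01 t = (0 <= t <= 1) :> Prop by rewrite /I01 /= in_itv.
(* Each edge is parametrised once, from its end of smaller rank; the other half runs backwards from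
   parameter 1, and the two meet at 1/2. *)
pose eta u v t := if lt u v then gam (u, v) (t / 2) else gam (v, u) (1 - t / 2).
have enq (u v : T) : e u v -> u != v by apply: contraTneq => ->; rewrite e_irr.
have eE u v : e u v -> [set u; v]%SET \in edges e.
  by move=> euv; rewrite inE; apply/existsP; exists u; apply/existsP; exists v; rewrite euv /=.
have in01 t : I01 t -> (t \in `[0, 1]) by rewrite inE.
have half t : I01 t -> I01 (t / 2) /\ I01 (1 - t / 2).
  by rewrite !I01E => /andP[t0 t1]; split; apply/andP; split; lra.
have I0 : I01 0 by rewrite I01E; lra.
have I1 : I01 1 by rewrite I01E; lra.
have eta_arc u v t : e u v -> I01 t -> arc [set u; v]%SET (eta u v t).
  move=> euv /half[t1 t2]; rewrite /eta; case: ifP => luv.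
    by have [_ _ _ _ ->] := gamP (u, v) euv; exists (t / 2).
  have evu : e v u by rewrite e_sym.
  by rewrite finset.setUC; have [_ _ _ _ ->] := gamP (v, u) evu; exists (1 - t / 2).
have eta_pt u v x t : e u v -> I01 t -> x \in [set u; v]%SET -> eta u v t = pt x -> x = u.
  move=> euv It; rewrite !inE => /orP[/eqP//|/eqP->]; have [t1 t2] := half t It.
  move: It; rewrite I01E => It; rewrite /eta; case: ifP => luv.
    have [_ inj _ <- _] := gamP (u, v) euv.
    move=> /(inj _ _ (in01 _ t1) (in01 _ I1)) eqt; exfalso; lra.
  have evu : e v u by rewrite e_sym.
  have [_ inj <- _ _] := gamP (v, u) evu.
  move=> /(inj _ _ (in01 _ t2) (in01 _ I0)) eqt; exfalso; lra.
exists pt, eta; split.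
- move=> u v euv; have evu : e v u by rewrite e_sym.
  have main p (k : R -> R) : e p.1 p.2 -> continuous k -> (forall t, I01 t -> I01 (k t)) ->
      {within `[0, 1], continuous (gam p \o k)}%classic.
    move=> ep ck kI; have [cg _ _ _ _] := gamP p ep.
    apply/subspace_continuousP => t It U /= Uk.
    have /subspace_continuousP/(_ _ (kI _ It) U Uk) H := cg.
    have {}H : nbhs (k t) [set s | I01 s -> U (gam p s)]%classic := H.
    have := ck t _ H => {}H; have {}H : nbhs t [set s | I01 (k s) -> U (gam p (k s))]%classic := H.
    suff : nbhs t [set s | I01 s -> U (gam p (k s))]%classic by [].
    by move: H; apply: filterS => s Hs Is; exact: (Hs (kI _ Is)).
  rewrite /eta; case: (lt u v).
    apply: (main (u, v) (fun t => t / 2)) => //=; last by move=> t /half[].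
    by move=> t; apply: cvgMr_tmp; exact: cvg_id.
  apply: (main (v, u) (fun t => 1 - t / 2)) => //=; last by move=> t /half[].
  by move=> t; apply: cvgB; [exact: cvg_cst|apply: cvgMr_tmp; exact: cvg_id].
- move=> u v euv; rewrite /eta; have evu : e v u by rewrite e_sym.
  case: ifP => luv; first by rewrite mul0r; have [] := gamP (u, v) euv.
  by rewrite mul0r subr0; have [] := gamP (v, u) evu.
- move=> u v euv; rewrite /eta (ltN _ _ (enq _ _ euv)); case: (lt u v) => /=; congr (gam _ _); lra.
- move=> u v u' v' t t' euv euv' uu' It It' eq_eta.
  have A1 := eta_arc _ _ _ euv It; have A2 := eta_arc _ _ _ euv' It'.
  have [eqf|nf] := eqVneq [set u; v]%SET [set u'; v']%SET.
    have : u' \in [set u; v]%SET by rewrite eqf !inE eqxx.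
    have : u \in [set u'; v']%SET by rewrite -eqf !inE eqxx.
    by rewrite !inE (eq_sym u' u) (negPf uu') => /= /eqP uv' /eqP u'v.
  have [x /= xI ptx] := arc_arc _ _ (eE _ _ euv) (eE _ _ euv') nf _ (conj A1 (eq_ind_r _ A2 eq_eta)).
  move: xI; rewrite inE => /andP[x1 x2].
  have xu := eta_pt _ _ _ _ euv It x1 (esym ptx).
  have xu' := eta_pt _ _ _ _ euv' It' x2 (etrans (esym eq_eta) (esym ptx)).
  by rewrite -xu -xu' eqxx in uu'.
- move=> u v w t evw uv It ptu.
  have [uin|uout] := boolP (u \in [set v; w]%SET).
    by have := eta_pt _ _ _ _ evw It uin (esym ptu) => uv'; rewrite uv' eqxx in uv.
  by apply: (arc_pt _ _ (eE _ _ evw) uout); rewrite ptu; apply: eta_arc.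
Qed.

Lemma finite_radius (R : realType) (I : finType) (P : I -> R -> Prop) :
  (forall i d d', P i d -> d' <= d -> P i d') ->
  (forall i, exists2 d, 0 < d & P i d) -> exists2 d, 0 < d & forall i, P i d.
Proof.
move=> mono /(_ _)/cid2-/all_sig2[f f0 fP].
exists (\big[Num.min/1]_i f i); first by apply/bigmin_gtP; split=> // i _.
by move=> i; apply: mono (fP i) _; apply: bigmin_le_cond.
Qed.

Lemma planar_grid_drawing (R : realType) (T : finType) (e : rel T)
    (e_sym : symmetric e) (e_irr : irreflexive e) : planar R e ->
  exists n root W, @is_grid_drawing T e n root W.
Proof.
move=> /(half_arcs e_sym e_irr)[pt [eta [eta_cont eta0 eta1 eta_sep pt_sep]]].
pose K u v := (eta u v @` `[0, 1])%classic.
pose near2 d (x y : R * R) := `|x.1 - y.1| < d /\ `|x.2 - y.2| < d.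
have cK u v : e u v -> compact (K u v).
  by move=> euv; apply: continuous_compact; [exact: eta_cont|exact: segment_compact].
have mono d d' x y : d' <= d -> near2 d' x y -> near2 d x y.
  by move=> dd [d1 d2]; split; exact: lt_le_trans dd.
(* The two halves of one edge share their midpoint, so this pair is exempt from separation. *)
have [d1 d1_gt0 d1P] : exists2 d, 0 < d & forall i : (T * T) * (T * T),
    e i.1.1 i.1.2 -> e i.2.1 i.2.2 -> i.1.1 != i.2.1 -> ~ (i.2.1 = i.1.2 /\ i.2.2 = i.1.1) ->
    forall x y, K i.1.1 i.1.2 x -> K i.2.1 i.2.2 y -> ~ near2 d x y.
  apply: finite_radius => [i d d' H dd e1 e2 n1 n2 x y Kx Ky|[[u v] [u' v']] /=].
    by move=> /(mono _ _ _ _ dd); apply: H.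
  have [euv|] := boolP (e u v); last by exists 1.
  have [euv'|] := boolP (e u' v'); last by exists 1.
  have [[nu nop]|H] := pselect (u != u' /\ ~ (u' = v /\ v' = u)); last first.
    by exists 1 => // _ _ h1 h2; case: H; split.
  have [|d d0 dP] := @compact_separation R _ _ (cK _ _ euv) (cK _ _ euv'); last by exists d.
  move=> x [t It <-] [t' It' /esym eq_eta]; apply: nop.
  exact: (eta_sep _ _ _ _ _ _ euv euv' nu It It' eq_eta).
have [d2 d2_gt0 d2P] : exists2 d, 0 < d & forall i : T * (T * T),
    e i.2.1 i.2.2 -> i.1 != i.2.1 -> forall y, K i.2.1 i.2.2 y -> ~ near2 d (pt i.1) y.
  apply: finite_radius => [i d d' H dd e1 n1 y Ky|[u [v w]] /=].
    by move=> /(mono _ _ _ _ dd); apply: H.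
  have [evw|] := boolP (e v w); last by exists 1.
  have [|uv] := boolP (u != v); last by exists 1.
  move=> uv; have [|d d0 dP] := @compact_separation R _ _ (@compact_set1 _ (pt u)) (cK _ _ evw).
    by move=> x -> [t It /esym]; exact: pt_sep.
  by exists d => // _ _ y Ky; apply: dP.
(* A common grid point is within 2h of both curves, which puts them within 4h of each other. *)
pose h := Num.min d1 d2 / 4.
have h0 : 0 < h by rewrite divr_gt0 // lt_min d1_gt0.
have hd1 : 2 * h + 2 * h <= d1.
  have -> : 2 * h + 2 * h = Num.min d1 d2 by rewrite /h; field.
  by rewrite ge_min lexx.
have hd2 : 2 * h + 2 * h <= d2.
  have -> : 2 * h + 2 * h = Num.min d1 d2 by rewrite /h; field.
  by rewrite ge_min lexx orbT.
have tri (z x y : R) : `|z - x| < 2 * h -> `|z - y| < 2 * h -> `|x - y| < 2 * h + 2 * h.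
  rewrite !ltr_norml => /andP[? ?] /andP[? ?]; apply/andP; split; lra.
have /choice[W0 W0P] (p : T * T) : exists s, e p.1 p.2 ->
   [/\ path grid_adj (round h (pt p.1)) s,
    last (round h (pt p.1)) s = round h (eta p.1 p.2 1) &
    {in round h (pt p.1) :: s, forall q, near_curve h (eta p.1 p.2) q}].
  have [ep|] := boolP (e p.1 p.2); last by exists [::].
  by have [s] := curve_walk h0 (eta_cont _ _ ep); rewrite eta0 //; exists s.
pose root0 u := round h (pt u).
have sep1 u v u' v' p : e u v -> e u' v' -> u != u' -> p \in root0 u :: W0 (u, v) ->
    p \in root0 u' :: W0 (u', v') -> u' = v /\ v' = u.
  move=> euv euv' nu p1 p2; apply: contrapT => nop.
  have [_ _ /(_ _ p1)[t It [t1 t2]]] := W0P (u, v) euv.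
  have [_ _ /(_ _ p2)[t' It' [t1' t2']]] := W0P (u', v') euv'.
  apply: (d1P ((u, v), (u', v')) euv euv' nu nop (eta u v t) (eta u' v' t')).
  - by exists t.
  - by exists t'.
  - by split; apply: lt_le_trans hd1; [apply: (tri (h * p.1%:~R))|apply: (tri (h * p.2%:~R))].
have sep2 u v w : e v w -> u != v -> root0 u \notin root0 v :: W0 (v, w).
  move=> evw uv; apply/negP => p1.
  have [_ _ /(_ _ p1)[t It [t1 t2]]] := W0P (v, w) evw.
  apply: (d2P (u, (v, w)) evw uv (eta v w t)); first by exists t.
  have near_pt (x : R) : `|h * (Num.floor (x / h))%:~R - x| < 2 * h.
    by apply: floor_dist => //; rewrite subrr normr0.
  by split; apply: lt_le_trans hd2; [apply: tri (near_pt _) t1|apply: tri (near_pt _) t2].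
pose pts : seq (int * int) := flatten [seq root0 p.1 :: W0 p | p : T * T].
pose N := (\max_(q <- pts) maxn `|q.1|%N `|q.2|%N)%N.
have NP p q : q \in root0 p.1 :: W0 p -> (`|q.1| <= N)%N && (`|q.2| <= N)%N.
  move=> qp; rewrite -geq_max; suff qpts : q \in pts by rewrite /N (big_rem q) //= leq_maxl.
  by apply/flattenP; exists (root0 p.1 :: W0 p) => //; apply/mapP; exists p; rewrite ?mem_enum.
clearbody N.
(* All coordinates lie between -N and N; the shift puts them in a square of side 2N + 1. *)
pose f (q : int * int) : nat * nat := (absz (q.1 + Posz N), absz (q.2 + Posz N)).
have f_adj p q : (`|p.1| <= N)%N && (`|p.2| <= N)%N -> (`|q.1| <= N)%N && (`|q.2| <= N)%N ->
    grid_adj p q -> natgrid_adj (f p) (f q).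
  by case: p q => [p1 p2] [q1 q2]; rewrite /grid_adj /natgrid_adj /=; lia.
have f_inj p q : (`|p.1| <= N)%N && (`|p.2| <= N)%N -> (`|q.1| <= N)%N && (`|q.2| <= N)%N ->
    f p = f q -> p = q.
  case: p q => [p1 p2] [q1 q2] /= /andP[a1 a2] /andP[b1 b2] [c1 c2].
  have e1 : p1 = q1 by clear - a1 b1 c1; lia.
  have e2 : p2 = q2 by clear - a2 b2 c2; lia.
  by rewrite e1 e2.
have Wb u v q : q \in root0 u :: W0 (u, v) -> (`|q.1| <= N)%N && (`|q.2| <= N)%N by exact: (NP (u, v)).
have rb u : (`|(root0 u).1| <= N)%N && (`|(root0 u).2| <= N)%N by apply: (Wb u u); exact: mem_head.
exists (N + N).+1, (fun u => f (root0 u)), (fun u v => map f (W0 (u, v))); split.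
- move=> u v euv; have [+ _ _] := W0P (u, v) euv; rewrite -/(root0 u).
  have := @Wb u v; move: (root0 u) (W0 (u, v)) => a s; elim: s a => //= b s IHs a Hb /andP[ab bs].
  rewrite f_adj ?Hb ?inE ?eqxx ?orbT //=; apply: IHs => // q qs; apply: Hb.
  by rewrite inE qs orbT.
- move=> u v euv; have evu : e v u by rewrite e_sym.
  rewrite !last_map; have [_ -> _] := W0P (u, v) euv; have [_ -> _] := W0P (v, u) evu.
  by rewrite /= eta1.
- move=> u v p euv; rewrite -map_cons => /mapP[q /Wb qb ->]; rewrite /f /=; move: qb; clear; case: q => q1 q2 /= /andP[b1 b2]; apply/andP; split; lia.
- move=> u v u' v' p euv euv' nu; rewrite -!map_cons => /mapP[q q1 ->] /mapP[q' q1' eq_f].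
  have eqq := f_inj _ _ (Wb _ _ _ q1) (Wb _ _ _ q1') eq_f; subst q'.
  exact: sep1 q1 q1'.
- move=> u v w evw uv; rewrite -map_cons; apply/mapP => -[q q1 eq_f].
  have := sep2 _ _ _ evw uv; rewrite (f_inj _ _ (rb u) (Wb _ _ _ q1) eq_f).
  by rewrite q1.
Qed.

(** * The packing edge-colouring *)

Lemma set2_eq (T : finType) (a b a' b' : T) : [set a; b]%SET = [set a'; b']%SET ->
  (a' = a /\ b' = b) \/ (a' = b /\ b' = a).
Proof.
move=> eqs; have /set2P ha : a \in [set a'; b']%SET by rewrite -eqs set21.
have /set2P hb : b \in [set a'; b']%SET by rewrite -eqs set22.
have /set2P ha' : a' \in [set a; b]%SET by rewrite eqs set21.
have /set2P hb' : b' \in [set a; b]%SET by rewrite eqs set22.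
by case: ha; case: hb; case: ha'; case: hb' => *;
  solve [left; split; congruence | right; split; congruence].
Qed.

Lemma edge_at (T : finType) (e : rel T) (e_sym : symmetric e) (f : {set T}) (u : T) :
  f \in edges e -> u \in f -> exists2 a, e u a & f = [set u; a]%SET.
Proof.
rewrite inE => /existsP[x /existsP[y /andP[xy /eqP ->]]]; rewrite !inE => /orP[]/eqP->.
  by exists y.
by exists x; rewrite 1?e_sym // finset.setUC.
Qed.

Lemma line_graphP (T : finType) (e : rel T) (e_sym : symmetric e) (f g : {set T}) :
  line_graph e f g -> exists u a b, [/\ e u a, e u b, f = [set u; a]%SET & g = [set u; b]%SET].
Proof.
case/and4P=> fE gE _ /pred0Pn[u /andP[/= uf ug]].
have [a ua ->] := edge_at e_sym fE uf; have [b ub ->] := edge_at e_sym gE ug.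
by exists u, a, b.
Qed.

(** Only short walks in the line graph have to be excluded: length 1 because colours at a vertex are
    distinct, length 2, for a nonzero colour, by compatibility along the middle edge. *)
Lemma colorable_packing (R : realType) (T : finType) (e : rel T) (e_sym : symmetric e) :
  colorable e [set: T]%SET -> has_packing_edge_coloring R e 1 4.
Proof.
case=> S [c [SP cS cinj cE]].
have inT x : x \in [set: T]%SET by rewrite inE.
have c_sym x y : e x y -> c x y = c y x by move=> xy; have [] := cE x y (inT x) (inT y) xy.
have c_inj x y z : e x y -> e x z -> c x y = c x z -> y = z by exact: cinj.
pose C (i : 'I_(1 + 4)) : {set {set T}} :=
  [set f : {set T} | [exists x, exists y, [&& e x y, f == [set x; y]%SET & c x y == i]]]%SET.
have CP i x y : e x y -> ([set x; y]%SET \in C i) = (c x y == i).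
  move=> xy; apply/idP/idP => [|cxy]; last first.
    by rewrite inE; apply/existsP; exists x; apply/existsP; exists y; rewrite xy eqxx.
  rewrite inE => /existsP[x' /existsP[y' /and3P[xy' /eqP eqf cxy']]].
  by have [[ex ey]|[ex ey]] := set2_eq eqf; subst; rewrite // c_sym.
have CE i f : f \in C i -> f \in edges e.
  rewrite !inE => /existsP[x /existsP[y /and3P[xy /eqP -> _]]].
  by apply/existsP; exists x; apply/existsP; exists y; rewrite xy eqxx.
have clash i x a b : e x a -> e x b -> [set x; a]%SET \in C i -> [set x; b]%SET \in C i -> a = b.
  by move=> xa xb; rewrite !CP // => /eqP ca /eqP cb; apply: (c_inj x) => //; rewrite ca cb.
exists C; split.
- apply/setP => f; apply/bigcupP/idP => [[i _ /CE]//|fE].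
  move: (fE); rewrite inE => /existsP[x /existsP[y /andP[xy /eqP eqf]]].
  have c5 : (c x y < 1 + 4)%N.
    have := SP x (inT x); rewrite palettesP => /and3P[_ _ /allP]; apply.
    exact: cS (inT x) (inT y) xy.
  by exists (Ordinal c5) => //; rewrite eqf CP.
- move=> i j; apply: contraR => /pred0Pn[f /andP[/= fi fj]].
  move: (CE _ _ fi); rewrite inE => /existsP[x /existsP[y /andP[xy /eqP eqf]]].
  by move: fi fj; rewrite eqf !CP // => /eqP ci /eqP cj; apply/eqP/val_inj; rewrite /= -ci -cj.
- move=> i f g fi gi fg; apply: le_ereal_inf_tmp => _ [p [pth lst] <-].
  rewrite lee_fin.
  case: p pth lst => [|h [|k [|l p]]] /=.
  + by move=> _ efg; rewrite efg eqxx in fg.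
  + rewrite andbT => fh hg; subst h.
    have [u [a [b [ua ub ef eg]]]] := line_graphP e_sym fh.
    by rewrite ef eg in fi gi fg; rewrite (clash _ _ _ _ ua ub fi gi) eqxx in fg.
  + rewrite andbT => /andP[fh hk] kg; subst k; case: ifP => i1; first by rewrite ler_nat.
    have [u [a [b [ua ub ef eh]]]] := line_graphP e_sym fh.
    have [v [b' [d [vb vd eh' eg]]]] := line_graphP e_sym hk.
    have : v \in [set u; b]%SET by rewrite -eh eh' !inE eqxx.
    rewrite !inE => /orP[]/eqP ev; subst v.
      by rewrite ef eg in fi gi fg; rewrite (clash _ _ _ _ ua vd fi gi) eqxx in fg.
    rewrite ef eg !CP // in fi gi; move/eqP in fi; move/eqP in gi.
    have [_ /and3P[_ _ /allP co]] := cE u b (inT u) (inT b) ub.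
    have iu : c u a \in S u by exact: cS.
    have iv : (i : nat) \in S b by rewrite -gi; exact: cS.
    (* A nonzero colour common to both palettes is that of the middle edge; then [f] and [g] both
       coincide with it. *)
    have := co _ iu; rewrite fi iv /= => /orP[/eqP i0|/eqP cub].
      by rewrite i0 in i1.
    have ab : a = b by apply: (c_inj u) => //; rewrite fi cub.
    have du : d = u by apply: (c_inj b) => //; [rewrite e_sym|rewrite -(c_sym u b) // -cub gi].
    by move: fg; rewrite ef eg ab du finset.setUC eqxx.
  + by move=> _ _; case: ifP => _; rewrite ler_nat.
Qed.

Theorem theorem1p2 (R : realType) (T : finType) (e : rel T)
    (e_sym : symmetric e) (e_irr : irreflexive e)
    (e_subcubic : subcubic e) (e_planar : planar R e)
    (e_girth : (16%:E <= girth R e)%E) :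
  has_packing_edge_coloring R e 1 4.
Proof.
have [n [root [W dr]]] := planar_grid_drawing e_sym e_irr e_planar.
apply: colorable_packing => //; apply: sparse_colorable => //.
- move=> c ec uc c3; rewrite -(ler_nat R) -lee_fin; apply: le_trans e_girth _.
  by apply: ereal_inf_lbound; exists c => //; split=> //; apply/andP.
- move=> V V0 deg; exact: (grid_drawing_sparse e_sym e_irr dr V0 deg).
Qed.
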